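(* Let a cocycle cross product bialgebra on $B_1\otimes B_2$ in $\mathcal C$ be given, with structure morphisms $\mathrm m_1,\eta_1,\Delta_1,\varepsilon_1,\mathrm m_2,\eta_2,\Delta_2,\varepsilon_2,\mu_l,\mu_r,\nu_l,\nu_r,\rho,\sigma$. Then $$\big((B_1,\mathrm m_1,\eta_1,\Delta_1,\varepsilon_1),(B_2,\mathrm m_2,\eta_2,\Delta_2,\varepsilon_2);\mu_l,\mu_r,\nu_l,\nu_r,\rho,\sigma\big)$$ is a Hopf datum.
   Context: $\mathcal C$ is a strict braided monoidal category with tensor product $\otimes$, unit object $\mathbb 1$ and braiding $\Psi$, in which idempotents split. Algebras, coalgebras, bialgebras, modules and comodules are taken in $\mathcal C$. Juxtaposition denotes composition; $\mathrm{id}$ without index is the identity of the object determined by the types. (A) Cross product algebra: let $(B_1,\mathrm m_1,\eta_1)$ be an algebra, $B_2$ an object, and $\eta_2:\mathbb 1\to B_2$, $\varphi_{2,1}:B_2\otimes B_1\to B_1\otimes B_2$, $\hat\sigma:B_2\otimes B_2\to B_1\otimes B_2$ morphisms with $\varphi_{2,1}=(\mathrm m_1\otimes\mathrm{id})(\mathrm{id}\otimes\hat\sigma)(\varphi_{2,1}\otimes\eta_2)$. If $B_1\otimes B_2$ is an algebra with multiplication $(\mathrm m_1\otimes\mathrm{id}_{B_2})(\mathrm m_1\otimes\hat\sigma)(\mathrm{id}_{B_1}\otimes\varphi_{2,1}\otimes\mathrm{id}_{B_2})$ and unit $\eta_1\otimes\eta_2$, it is a cross product algebra. Cross product coalgebra: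 let $(B_2,\Delta_2,\varepsilon_2)$ be a coalgebra, $B_1$ an object, and $\varepsilon_1:B_1\to\mathbb 1$, $\varphi_{1,2}:B_1\otimes B_2\to B_2\otimes B_1$, $\hat\rho:B_1\otimes B_2\to B_1\otimes B_1$ morphisms with $\varphi_{1,2}=(\varepsilon_1\otimes\varphi_{1,2})(\hat\rho\otimes\mathrm{id})(\mathrm{id}\otimes\Delta_2)$. If $B_1\otimes B_2$ is a coalgebra with comultiplication $(\mathrm{id}_{B_1}\otimes\varphi_{1,2}\otimes\mathrm{id}_{B_2})(\hat\rho\otimes\Delta_2)(\mathrm{id}_{B_1}\otimes\Delta_2)$ and counit $\varepsilon_1\otimes\varepsilon_2$, it is a cross product coalgebra. Cross product bialgebra: a bialgebra whose algebra is a cross product algebra and whose coalgebra is a cross product coalgebra on the same objects $B_1,B_2$; normalized if $\varepsilon_1\eta_1=\mathrm{id}_{\mathbb 1}$ (equivalently $\varepsilon_2\eta_2=\mathrm{id}_{\mathbb 1}$). (B) Structure morphisms. Besides $\mathrm m_1:B_1\otimes B_1\to B_1$, $\eta_1:\mathbb 1\to B_1$, $\varepsilon_1:B_1\to\mathbb 1$, $\Delta_2:B_2\to B_2\otimes B_2$, $\eta_2:\mathbb 1\to B_2$, $\varepsilon_2:B_2\to\mathbb 1$, consider $\Delta_1:B_1\to B_1\otimes B_1$, $\mathrm m_2:B_2\otimes B_2\to B_2$, $\mu_l:B_2\otimes B_1\to B_1$, $\mu_r:B_2\otimes B_1\to B_2$, $\nu_l:B_1\to B_2\otimes B_1$, $\nu_r:B_2\to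 B_2\otimes B_1$, $\sigma:B_2\otimes B_2\to B_1$, $\rho:B_2\to B_1\otimes B_1$. Put $\alpha=\mathrm m_2(\mu_r\otimes\mathrm{id}_{B_2})$, $\beta=(\nu_r\otimes\mathrm{id}_{B_2})\Delta_2$, $\lambda=\mathrm m_1(\mathrm{id}_{B_1}\otimes\mu_l)$, $\zeta=(\mathrm{id}_{B_1}\otimes\nu_l)\Delta_1$ and $$\varphi_{1,2}=(\mathrm m_2\otimes\mathrm m_1)(\mathrm{id}_{B_2}\otimes\Psi_{B_1,B_2}\otimes\mathrm{id}_{B_1})(\nu_l\otimes\nu_r),\quad \varphi_{2,1}=(\mu_l\otimes\mu_r)(\mathrm{id}_{B_2}\otimes\Psi_{B_2,B_1}\otimes\mathrm{id}_{B_1})(\Delta_2\otimes\Delta_1),$$ $$\hat\sigma=(\sigma\otimes\alpha)(\mathrm{id}_{B_2}\otimes\Psi_{B_2,B_2}\otimes\mathrm{id}_{B_1\otimes B_2})(\Delta_2\otimes\beta),\quad \hat\rho=(\lambda\otimes\mathrm m_1)(\mathrm{id}_{B_1\otimes B_2}\otimes\Psi_{B_1,B_1}\otimes\mathrm{id}_{B_1})(\zeta\otimes\rho).\qquad( * )$$ Further put $\kappa=\mathrm m_1(\mathrm m_1\otimes\sigma)(\mathrm{id}_{B_1}\otimes\varphi_{2,1}\otimes\mathrm{id}_{B_2}):B_1\otimes B_2\otimes B_1\otimes B_2\to B_1$, $\omega=(\mathrm{id}_{B_1}\otimes\varphi_{1,2}\otimes\mathrm{id}_{B_2})(\rho\otimes\Delta_2)\Delta_2:B_2\to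 B_1\otimes B_2\otimes B_1\otimes B_2$, $\Theta=\Psi_{B_1\otimes B_2,\,B_1\otimes B_2}$. (C) Cocycle cross product bialgebra: a normalized cross product bialgebra together with morphisms $\Delta_1,\mathrm m_2,\mu_l,\mu_r,\nu_l,\nu_r,\sigma,\rho$ such that its $\varphi_{1,2},\varphi_{2,1},\hat\sigma,\hat\rho$ are given by $( * )$, the (co)unital identities (U1) $\Delta_1\eta_1=\eta_1\otimes\eta_1$, $(\mathrm{id}\otimes\varepsilon_1)\Delta_1=(\varepsilon_1\otimes\mathrm{id})\Delta_1=\mathrm{id}_{B_1}$, $\varepsilon_2\mathrm m_2=\varepsilon_2\otimes\varepsilon_2$, $\mathrm m_2(\mathrm{id}\otimes\eta_2)=\mathrm m_2(\eta_2\otimes\mathrm{id})=\mathrm{id}_{B_2}$; (U2) $\mu_r(\eta_2\otimes\mathrm{id})=\eta_2\varepsilon_1$, $\varepsilon_2\mu_r=\varepsilon_2\otimes\varepsilon_1$, $(\mathrm{id}\otimes\varepsilon_1)\nu_l=\eta_2\varepsilon_1$, $\nu_l\eta_1=\eta_2\otimes\eta_1$, $\mu_l(\eta_2\otimes\mathrm{id})=\mathrm{id}_{B_1}$, $\mu_l(\mathrm{id}\otimes\eta_1)=\eta_1\varepsilon_2$, $\varepsilon_1\mu_l=\varepsilon_2\otimes\varepsilon_1$, $(\mathrm{id}\otimes\varepsilon_1)\nu_r=\mathrm{id}_{B_2}$, $(\varepsilon_2\otimes\mathrm{id})\nu_r=\eta_1\varepsilon_2$, $\nu_r\eta_2=\eta_2\otimes\eta_1$;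 (U3) $\mu_r(\mathrm{id}\otimes\eta_1)=\mathrm{id}_{B_2}$, $(\varepsilon_2\otimes\mathrm{id})\nu_l=\mathrm{id}_{B_1}$ hold, and $$(\mathrm m_2\otimes\mathrm{id})(\mathrm{id}\otimes\nu_r)=(\mathrm m_2\otimes\mathrm{id})(\mu_r\otimes\varphi_{1,2})(\mathrm{id}\otimes(\rho\otimes\mathrm{id})\Delta_2),$$ $$(\mu_l\otimes\mathrm{id})(\mathrm{id}\otimes\Delta_1)=(\mathrm m_1(\mathrm{id}\otimes\sigma)\otimes\mathrm{id})(\varphi_{2,1}\otimes\nu_l)(\mathrm{id}\otimes\Delta_1).$$ (D) Hopf datum: a tuple $\big((B_1,\mathrm m_1,\eta_1,\Delta_1,\varepsilon_1),(B_2,\mathrm m_2,\eta_2,\Delta_2,\varepsilon_2);\mu_l,\mu_r,\nu_l,\nu_r,\rho,\sigma\big)$ of objects and morphisms of the types in (B) such that: 1. $(B_1,\mathrm m_1,\eta_1)$ is an algebra and $\varepsilon_1$ an algebra morphism; 2. $(B_2,\Delta_2,\varepsilon_2)$ is a coalgebra and $\eta_2$ a coalgebra morphism; 3. $(B_1,\nu_l)$ is a left $B_2$-comodule; 4. $(B_2,\mu_r)$ is a right $B_1$-module; 5. (U1) and (U2) hold, and $\sigma(\eta_2\otimes\mathrm{id})=\sigma(\mathrm{id}\otimes\eta_2)=\eta_1\varepsilon_2$, $\varepsilon_1\sigma=\varepsilon_2\otimes\varepsilon_2$, $(\mathrm{id}\otimes\varepsilon_1)\rho=(\varepsilon_1\otimes\mathrm{id})\rho=\eta_1\varepsilon_2$,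 $\rho\eta_2=\eta_1\otimes\eta_1$; 6. with $\varphi_{1,2},\varphi_{2,1},\hat\sigma,\hat\rho$ defined by $( * )$, the following compatibilities hold: - weak (co)associativity of $\mathrm m_2$, $\Delta_1$: $\mathrm m_2(\mathrm m_2\otimes\mathrm{id})=\mathrm m_2(\mu_r\otimes\mathrm{id})(\mathrm{id}\otimes\hat\sigma)$; $(\mathrm{id}\otimes\Delta_1)\Delta_1=(\hat\rho\otimes\mathrm{id})(\mathrm{id}\otimes\nu_l)\Delta_1$; - weak (co)associativity of $\mu_l$, $\nu_r$: $\mathrm m_1(\mathrm{id}\otimes\mu_l)(\hat\sigma\otimes\mathrm{id})=\mathrm m_1(\mathrm{id}\otimes\sigma)(\varphi_{2,1}\otimes\mathrm{id})(\mathrm{id}\otimes\varphi_{2,1})$; $(\mathrm{id}\otimes\hat\rho)(\nu_r\otimes\mathrm{id})\Delta_2=(\varphi_{1,2}\otimes\mathrm{id})(\mathrm{id}\otimes\varphi_{1,2})(\rho\otimes\mathrm{id})\Delta_2$; - module-algebra: $\mu_l(\mathrm{id}\otimes\mathrm m_1)=\mathrm m_1(\mathrm{id}\otimes\mu_l)(\varphi_{2,1}\otimes\mathrm{id})$; $\mu_r(\mathrm m_2\otimes\mathrm{id})=\mathrm m_2(\mu_r\otimes\mathrm{id})(\mathrm{id}\otimes\varphi_{2,1})$; - comodule-coalgebra: $(\mathrm{id}\otimes\Delta_1)\nu_l=(\varphi_{1,2}\otimes\mathrm{id})(\mathrm{id}\otimes\nu_l)\Delta_1$; $(\Delta_2\otimes\mathrm{id})\nu_r=(\mathrm{id}\otimes\varphi_{1,2})(\nu_r\otimes\mathrm{id})\Delta_2$;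 - cocycle and cycle: $\mathrm m_1(\mathrm{id}\otimes\sigma)(\hat\sigma\otimes\mathrm{id})=\mathrm m_1(\mathrm{id}\otimes\sigma)(\varphi_{2,1}\otimes\mathrm{id})(\mathrm{id}\otimes\hat\sigma)$; $(\mathrm{id}\otimes\hat\rho)(\rho\otimes\mathrm{id})\Delta_2=(\hat\rho\otimes\mathrm{id})(\mathrm{id}\otimes\varphi_{1,2})(\rho\otimes\mathrm{id})\Delta_2$; - algebra-coalgebra: $\Delta_1\mathrm m_1=(\lambda\otimes\mathrm m_1)(\mathrm{id}_{B_1\otimes B_2}\otimes\Psi_{B_1,B_1}\otimes\mathrm{id}_{B_1})(\zeta\otimes\Delta_1)$; $\Delta_2\mathrm m_2=(\mathrm m_2\otimes\alpha)(\mathrm{id}_{B_2}\otimes\Psi_{B_2,B_2}\otimes\mathrm{id}_{B_1\otimes B_2})(\Delta_2\otimes\beta)$; - module-coalgebra: $\hat\rho\,\varphi_{2,1}=(\kappa\otimes\lambda)(\mathrm{id}_{B_1\otimes B_2}\otimes\Theta\otimes\mathrm{id}_{B_1})(\omega\otimes\zeta)$; $\Delta_2\mu_r=(\alpha\otimes\mu_r)(\mathrm{id}_{B_2}\otimes\Psi_{B_2,B_1\otimes B_2}\otimes\mathrm{id}_{B_1})(\Delta_2\otimes\zeta)$; - comodule-algebra: $\nu_l\mathrm m_1=(\alpha\otimes\mathrm m_1)(\mathrm{id}_{B_2}\otimes\Psi_{B_1,B_1\otimes B_2}\otimes\mathrm{id}_{B_1})(\nu_l\otimes\zeta)$; $\varphi_{1,2}\hat\sigma=(\alpha\otimes\kappa)(\mathrm{id}_{B_2}\otimes\Theta\otimes\mathrm{id}_{B_1\otimes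 B_2})(\beta\otimes\omega)$; - module-comodule: $\varphi_{1,2}\varphi_{2,1}=(\alpha\otimes\lambda)(\mathrm{id}_{B_2}\otimes\Theta\otimes\mathrm{id}_{B_1})(\beta\otimes\zeta)$; - cycle-cocycle: $\hat\rho\hat\sigma=(\kappa\otimes\kappa)(\mathrm{id}_{B_1\otimes B_2}\otimes\Theta\otimes\mathrm{id}_{B_1\otimes B_2})(\omega\otimes\omega)$. *)

(* Defs.v *)
From mathcomp Require Import all_boot.
Set Implicit Arguments.
Unset Strict Implicit.
Unset Printing Implicit Defensive.

Declare Scope scat_scope.
Delimit Scope scat_scope with scat.

Record category := Category {
  Ob :> Type;
  Hom : Ob -> Ob -> Type;
  idm : forall A, Hom A A;
  compm : forall A B D, Hom B D -> Hom A B -> Hom A D;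
  compmA : forall A B D E (h : Hom D E) (g : Hom B D) (f : Hom A B),
    compm h (compm g f) = compm (compm h g) f;
  compm1f : forall A B (f : Hom A B), compm (idm B) f = f;
  compmf1 : forall A B (f : Hom A B), compm f (idm A) = f }.

Arguments Hom {c} A B.
Arguments idm {c} A.
Arguments compm {c A B D} g f : rename.

Definition split_idempotents (C : category) : Prop :=
  forall (A : C) (e : Hom A A), compm e e = e ->
  exists (X : C) (p : Hom A X) (i : Hom X A),
    compm p i = idm X /\ compm i p = e.

(* Transport of a morphism along equalities of its source and target; needed  *)
(* because the tensor product of objects of a strict monoidal category is     *)
(* associative and unital only up to propositional equality.                  *)
Definition castHom (C : category) (A A' B B' : C) (eA : A = A') (eB : B = B')
    (f : Hom A B) : Hom A' B' :=
  ecast X (Hom X B') eA (ecast Y (Hom A Y) eB f).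

Record smcat := SMCat {
  smcat_cat :> category;
  unit_ob : smcat_cat;
  tens : smcat_cat -> smcat_cat -> smcat_cat;
  tensf : forall A A' B B', @Hom smcat_cat A A' -> @Hom smcat_cat B B' ->
    Hom (tens A B) (tens A' B');
  tensA : forall A B D, tens A (tens B D) = tens (tens A B) D;
  tens1o : forall A, tens unit_ob A = A;
  tenso1 : forall A, tens A unit_ob = A;
  tensf_id : forall A B, tensf (idm A) (idm B) = idm (tens A B);
  tensf_comp : forall A A' A'' B B' B''
      (f' : Hom A' A'') (f : Hom A A') (g' : Hom B' B'') (g : Hom B B'),
    tensf (compm f' f) (compm g' g) = compm (tensf f' g') (tensf f g);
  tensfA : forall A A' B B' D D'
      (f : Hom A A') (g : Hom B B') (h : Hom D D'),
    castHom (tensA A B D) (tensA A' B' D') (tensf f (tensf g h)) =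
      tensf (tensf f g) h;
  tens1f : forall A A' (f : Hom A A'),
    castHom (tens1o A) (tens1o A') (tensf (idm unit_ob) f) = f;
  tensf1 : forall A A' (f : Hom A A'),
    castHom (tenso1 A) (tenso1 A') (tensf f (idm unit_ob)) = f }.

Arguments unit_ob {s}.
Arguments tens {s} A B : rename.
Arguments tensf {s A A' B B'} f g : rename.
Arguments tensA {s} A B D : rename.

(* To write equations between morphisms without visible transports, sources   *)
(* and targets are presented as words of objects: [:: A; B; D] stands for     *)
(* A (x) (B (x) D), [:: A] for A, and [::] for the unit object, and these are *)
(* convertible.  Hence mor [:: A; B] [:: D] is convertible to                 *)
(* Hom (tens A B) D, and concatenation of explicit words, unlike tens, is     *)
(* associative and unital by computation.                                     *)
Section Words.
Variable C : smcat.

Fixpoint prodw (s : seq C) : C :=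
  match s with
  | [::] => unit_ob
  | A :: s' => if s' is [::] then A else tens A (prodw s')
  end.

Lemma prodw_cat (s t : seq C) : tens (prodw s) (prodw t) = prodw (s ++ t).
Proof.
elim: s => [|A s IHs] /=; first exact: tens1o.
case: s IHs => [_|B s IHs] /=; last by rewrite -tensA IHs.
by case: t => [|B t] //=; rewrite tenso1.
Qed.

Definition mor (s t : seq C) : Type := Hom (prodw s) (prodw t).

Definition idw (s : seq C) : mor s s := idm (prodw s).

Definition compw (s t u : seq C) (g : mor t u) (f : mor s t) : mor s u :=
  compm g f.

Definition tensw (s s' t t' : seq C) (f : mor s s') (g : mor t t') :
    mor (s ++ t) (s' ++ t') :=
  castHom (prodw_cat s t) (prodw_cat s' t') (tensf f g).

End Words.

Arguments idw {C} s.
Arguments compw {C s t u} g f.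
Arguments tensw {C s s' t t'} f g.

Notation "g ∘ f" := (compw g f)
  (at level 40, left associativity) : scat_scope.
Notation "f ⊗ g" := (tensw f g)
  (at level 39, left associativity) : scat_scope.
Local Open Scope scat_scope.

(* In the hexagon identities the braidings with a composite index are         *)
(* regrouped along tensA, as (A (x) B) (x) D = A (x) (B (x) D).               *)
Record sbmcat := SBMCat {
  sbmcat_smcat :> smcat;
  braid : forall A B : sbmcat_smcat, Hom (tens A B) (tens B A);
  braid_inv : forall A B : sbmcat_smcat, Hom (tens B A) (tens A B);
  braidK : forall A B, compm (braid_inv A B) (braid A B) = idm (tens A B);
  braidVK : forall A B, compm (braid A B) (braid_inv A B) = idm (tens B A);
  braid_nat : forall (A A' B B' : sbmcat_smcat) (f : Hom A A') (g : Hom B B'),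
    compm (tensf g f) (braid A B) = compm (braid A' B') (tensf f g);
  braid_hexl : forall A B D : sbmcat_smcat,
    castHom (esym (tensA A B D)) erefl (braid (tens A B) D)
      = ((braid A D : mor [:: A; D] [:: D; A]) ⊗ idw [:: B])
        ∘ (idw [:: A] ⊗ (braid B D : mor [:: B; D] [:: D; B]))
      :> mor [:: A; B; D] [:: D; A; B];
  braid_hexr : forall A B D : sbmcat_smcat,
    castHom erefl (esym (tensA B D A)) (braid A (tens B D))
      = (idw [:: B] ⊗ (braid A D : mor [:: A; D] [:: D; A]))
        ∘ ((braid A B : mor [:: A; B] [:: B; A]) ⊗ idw [:: D])
      :> mor [:: A; B; D] [:: B; D; A] }.

Definition braidw (C : sbmcat) (s t : seq C) : mor (s ++ t) (t ++ s) :=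
  castHom (prodw_cat s t) (prodw_cat t s) (braid (prodw s) (prodw t)).

Arguments braidw {C} s t.

Notation "'Ψ[' s , t ]" := (braidw s t)
  (at level 0, s, t at level 99, format "'Ψ[' s ,  t ]") : scat_scope.

Section Algebras.
Variable C : sbmcat.

Definition is_algebra (A : C) (m : mor [:: A; A] [:: A]) (e : mor [::] [:: A])
    : Prop :=
  [/\ m ∘ (m ⊗ idw [:: A]) = m ∘ (idw [:: A] ⊗ m),
      m ∘ (e ⊗ idw [:: A]) = idw [:: A]
    & m ∘ (idw [:: A] ⊗ e) = idw [:: A]].

Definition is_coalgebra (A : C) (d : mor [:: A] [:: A; A])
    (c : mor [:: A] [::]) : Prop :=
  [/\ (d ⊗ idw [:: A]) ∘ d = (idw [:: A] ⊗ d) ∘ d,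
      (c ⊗ idw [:: A]) ∘ d = idw [:: A]
    & (idw [:: A] ⊗ c) ∘ d = idw [:: A]].

Definition is_bialgebra (A : C) (m : mor [:: A; A] [:: A])
    (e : mor [::] [:: A]) (d : mor [:: A] [:: A; A]) (c : mor [:: A] [::])
    : Prop :=
  [/\ is_algebra m e /\ is_coalgebra d c,
      d ∘ m = (m ⊗ m) ∘ (idw [:: A] ⊗ Ψ[[:: A], [:: A]] ⊗ idw [:: A])
                ∘ (d ⊗ d),
      d ∘ e = e ⊗ e,
      c ∘ m = c ⊗ c
    & c ∘ e = idw [::]].

Definition is_left_comodule (A M : C) (d : mor [:: A] [:: A; A])
    (c : mor [:: A] [::]) (nu : mor [:: M] [:: A; M]) : Prop :=
  (d ⊗ idw [:: M]) ∘ nu = (idw [:: A] ⊗ nu) ∘ nu /\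
  (c ⊗ idw [:: M]) ∘ nu = idw [:: M].

Definition is_right_module (A M : C) (m : mor [:: A; A] [:: A])
    (e : mor [::] [:: A]) (mu : mor [:: M; A] [:: M]) : Prop :=
  mu ∘ (mu ⊗ idw [:: A]) = mu ∘ (idw [:: M] ⊗ m) /\
  mu ∘ (idw [:: M] ⊗ e) = idw [:: M].

(* A morphism to the unit object is an algebra morphism, resp. a morphism     *)
(* from the unit object is a coalgebra morphism.                              *)
Definition is_augmentation (A : C) (m : mor [:: A; A] [:: A])
    (e : mor [::] [:: A]) (c : mor [:: A] [::]) : Prop :=
  c ∘ m = c ⊗ c /\ c ∘ e = idw [::].

Definition is_coaugmentation (A : C) (d : mor [:: A] [:: A; A])
    (c : mor [:: A] [::]) (e : mor [::] [:: A]) : Prop :=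
  d ∘ e = e ⊗ e /\ c ∘ e = idw [::].

End Algebras.

Section CrossProducts.
Variables (C : sbmcat) (B1 B2 : C).

Local Notation id1 := (idw [:: B1]).
Local Notation id2 := (idw [:: B2]).

(* The formulas give morphisms between the words [:: B1; B2; B1; B2] and      *)
(* [:: B1; B2]; they are regrouped into morphisms between P (x) P and P for   *)
(* the object P = B1 (x) B2.                                                  *)
Definition cp_mul (m1 : mor [:: B1; B1] [:: B1])
    (phi21 : mor [:: B2; B1] [:: B1; B2])
    (sigmah : mor [:: B2; B2] [:: B1; B2])
    : mor [:: tens B1 B2; tens B1 B2] [:: tens B1 B2] :=
  castHom (tensA B1 B2 (tens B1 B2)) erefl
    ((m1 ⊗ id2) ∘ (m1 ⊗ sigmah) ∘ (id1 ⊗ phi21 ⊗ id2)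
      : mor [:: B1; B2; B1; B2] [:: B1; B2]).

Definition cp_unit (eta1 : mor [::] [:: B1]) (eta2 : mor [::] [:: B2])
    : mor [::] [:: tens B1 B2] :=
  (eta1 ⊗ eta2 : mor [::] [:: B1; B2]).

Definition cp_comul (Delta2 : mor [:: B2] [:: B2; B2])
    (phi12 : mor [:: B1; B2] [:: B2; B1])
    (rhoh : mor [:: B1; B2] [:: B1; B1])
    : mor [:: tens B1 B2] [:: tens B1 B2; tens B1 B2] :=
  castHom erefl (tensA B1 B2 (tens B1 B2))
    ((id1 ⊗ phi12 ⊗ id2) ∘ (rhoh ⊗ Delta2) ∘ (id1 ⊗ Delta2)
      : mor [:: B1; B2] [:: B1; B2; B1; B2]).

Definition cp_counit (eps1 : mor [:: B1] [::]) (eps2 : mor [:: B2] [::])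
    : mor [:: tens B1 B2] [::] :=
  (eps1 ⊗ eps2 : mor [:: B1; B2] [::]).

Definition is_cross_product_algebra (m1 : mor [:: B1; B1] [:: B1])
    (eta1 : mor [::] [:: B1]) (eta2 : mor [::] [:: B2])
    (phi21 : mor [:: B2; B1] [:: B1; B2])
    (sigmah : mor [:: B2; B2] [:: B1; B2]) : Prop :=
  [/\ is_algebra m1 eta1,
      phi21 = (m1 ⊗ id2) ∘ (id1 ⊗ sigmah) ∘ (phi21 ⊗ eta2)
    & is_algebra (cp_mul m1 phi21 sigmah) (cp_unit eta1 eta2)].

Definition is_cross_product_coalgebra (Delta2 : mor [:: B2] [:: B2; B2])
    (eps2 : mor [:: B2] [::]) (eps1 : mor [:: B1] [::])
    (phi12 : mor [:: B1; B2] [:: B2; B1])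
    (rhoh : mor [:: B1; B2] [:: B1; B1]) : Prop :=
  [/\ is_coalgebra Delta2 eps2,
      phi12 = (eps1 ⊗ phi12) ∘ (rhoh ⊗ id2) ∘ (id1 ⊗ Delta2)
    & is_coalgebra (cp_comul Delta2 phi12 rhoh) (cp_counit eps1 eps2)].

Definition is_cross_product_bialgebra
    (m1 : mor [:: B1; B1] [:: B1]) (eta1 : mor [::] [:: B1])
    (eps1 : mor [:: B1] [::])
    (Delta2 : mor [:: B2] [:: B2; B2]) (eta2 : mor [::] [:: B2])
    (eps2 : mor [:: B2] [::])
    (phi12 : mor [:: B1; B2] [:: B2; B1]) (phi21 : mor [:: B2; B1] [:: B1; B2])
    (sigmah : mor [:: B2; B2] [:: B1; B2])
    (rhoh : mor [:: B1; B2] [:: B1; B1]) : Prop :=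
  [/\ is_cross_product_algebra m1 eta1 eta2 phi21 sigmah,
      is_cross_product_coalgebra Delta2 eps2 eps1 phi12 rhoh
    & is_bialgebra (cp_mul m1 phi21 sigmah) (cp_unit eta1 eta2)
        (cp_comul Delta2 phi12 rhoh) (cp_counit eps1 eps2)].

Definition is_normalized (eta1 : mor [::] [:: B1]) (eps1 : mor [:: B1] [::])
    : Prop :=
  eps1 ∘ eta1 = idw [::].

Record structure_morphisms := StructureMorphisms {
  m1 : mor [:: B1; B1] [:: B1];
  eta1 : mor [::] [:: B1];
  Delta1 : mor [:: B1] [:: B1; B1];
  eps1 : mor [:: B1] [::];
  m2 : mor [:: B2; B2] [:: B2];
  eta2 : mor [::] [:: B2];
  Delta2 : mor [:: B2] [:: B2; B2];
  eps2 : mor [:: B2] [::];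
  mu_l : mor [:: B2; B1] [:: B1];
  mu_r : mor [:: B2; B1] [:: B2];
  nu_l : mor [:: B1] [:: B2; B1];
  nu_r : mor [:: B2] [:: B2; B1];
  rho : mor [:: B2] [:: B1; B1];
  sigma : mor [:: B2; B2] [:: B1] }.

End CrossProducts.

Section HopfData.
Variables (C : sbmcat) (B1 B2 : C) (D : structure_morphisms B1 B2).

Local Notation id1 := (idw [:: B1]).
Local Notation id2 := (idw [:: B2]).
Local Notation id12 := (idw [:: B1; B2]).
Local Notation m1 := (m1 D).
Local Notation eta1 := (eta1 D).
Local Notation Delta1 := (Delta1 D).
Local Notation eps1 := (eps1 D).
Local Notation m2 := (m2 D).
Local Notation eta2 := (eta2 D).
Local Notation Delta2 := (Delta2 D).
Local Notation eps2 := (eps2 D).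
Local Notation mu_l := (mu_l D).
Local Notation mu_r := (mu_r D).
Local Notation nu_l := (nu_l D).
Local Notation nu_r := (nu_r D).
Local Notation rho := (rho D).
Local Notation sigma := (sigma D).

Definition alpha : mor [:: B2; B1; B2] [:: B2] := m2 ∘ (mu_r ⊗ id2).

Definition beta : mor [:: B2] [:: B2; B1; B2] := (nu_r ⊗ id2) ∘ Delta2.

Definition lambda : mor [:: B1; B2; B1] [:: B1] := m1 ∘ (id1 ⊗ mu_l).

Definition zeta : mor [:: B1] [:: B1; B2; B1] := (id1 ⊗ nu_l) ∘ Delta1.

Definition phi12 : mor [:: B1; B2] [:: B2; B1] :=
  (m2 ⊗ m1) ∘ (id2 ⊗ Ψ[[:: B1], [:: B2]] ⊗ id1) ∘ (nu_l ⊗ nu_r).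

Definition phi21 : mor [:: B2; B1] [:: B1; B2] :=
  (mu_l ⊗ mu_r) ∘ (id2 ⊗ Ψ[[:: B2], [:: B1]] ⊗ id1) ∘ (Delta2 ⊗ Delta1).

Definition sigma_hat : mor [:: B2; B2] [:: B1; B2] :=
  (sigma ⊗ alpha) ∘ (id2 ⊗ Ψ[[:: B2], [:: B2]] ⊗ id12) ∘ (Delta2 ⊗ beta).

Definition rho_hat : mor [:: B1; B2] [:: B1; B1] :=
  (lambda ⊗ m1) ∘ (id12 ⊗ Ψ[[:: B1], [:: B1]] ⊗ id1) ∘ (zeta ⊗ rho).

Definition kappa : mor [:: B1; B2; B1; B2] [:: B1] :=
  m1 ∘ (m1 ⊗ sigma) ∘ (id1 ⊗ phi21 ⊗ id2).

Definition omega : mor [:: B2] [:: B1; B2; B1; B2] :=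
  (id1 ⊗ phi12 ⊗ id2) ∘ (rho ⊗ Delta2) ∘ Delta2.

Definition Theta : mor [:: B1; B2; B1; B2] [:: B1; B2; B1; B2] :=
  Ψ[[:: B1; B2], [:: B1; B2]].

Definition unitalU1 : Prop :=
  [/\ Delta1 ∘ eta1 = eta1 ⊗ eta1,
      (id1 ⊗ eps1) ∘ Delta1 = id1 /\ (eps1 ⊗ id1) ∘ Delta1 = id1,
      eps2 ∘ m2 = eps2 ⊗ eps2
    & m2 ∘ (id2 ⊗ eta2) = id2 /\ m2 ∘ (eta2 ⊗ id2) = id2].

Record unitalU2 : Prop := UnitalU2 {
  U2_mur_eta2 : mu_r ∘ (eta2 ⊗ id1) = eta2 ∘ eps1;
  U2_eps2_mur : eps2 ∘ mu_r = eps2 ⊗ eps1;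
  U2_eps1_nul : (id2 ⊗ eps1) ∘ nu_l = eta2 ∘ eps1;
  U2_nul_eta1 : nu_l ∘ eta1 = eta2 ⊗ eta1;
  U2_mul_eta2 : mu_l ∘ (eta2 ⊗ id1) = id1;
  U2_mul_eta1 : mu_l ∘ (id2 ⊗ eta1) = eta1 ∘ eps2;
  U2_eps1_mul : eps1 ∘ mu_l = eps2 ⊗ eps1;
  U2_eps1_nur : (id2 ⊗ eps1) ∘ nu_r = id2;
  U2_eps2_nur : (eps2 ⊗ id1) ∘ nu_r = eta1 ∘ eps2;
  U2_nur_eta2 : nu_r ∘ eta2 = eta2 ⊗ eta1 }.

Definition unitalU3 : Prop :=
  mu_r ∘ (id2 ⊗ eta1) = id2 /\ (eps2 ⊗ id1) ∘ nu_l = id1.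

Record is_cocycle_cross_product_bialgebra : Prop := CocycleCPB {
  ccpb_bialgebra : is_cross_product_bialgebra m1 eta1 eps1 Delta2 eta2 eps2
    phi12 phi21 sigma_hat rho_hat;
  ccpb_normalized : is_normalized eta1 eps1;
  ccpb_U1 : unitalU1;
  ccpb_U2 : unitalU2;
  ccpb_U3 : unitalU3;
  ccpb_nur :
    (m2 ⊗ id1) ∘ (id2 ⊗ nu_r)
    = (m2 ⊗ id1) ∘ (mu_r ⊗ phi12) ∘ (id2 ⊗ ((rho ⊗ id2) ∘ Delta2));
  ccpb_mul :
    (mu_l ⊗ id1) ∘ (id2 ⊗ Delta1)
    = ((m1 ∘ (id1 ⊗ sigma)) ⊗ id1) ∘ (phi21 ⊗ nu_l) ∘ (id2 ⊗ Delta1) }.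

Definition unital_sigma_rho : Prop :=
  [/\ sigma ∘ (eta2 ⊗ id2) = eta1 ∘ eps2 /\
        sigma ∘ (id2 ⊗ eta2) = eta1 ∘ eps2,
      eps1 ∘ sigma = eps2 ⊗ eps2,
      (id1 ⊗ eps1) ∘ rho = eta1 ∘ eps2 /\
        (eps1 ⊗ id1) ∘ rho = eta1 ∘ eps2
    & rho ∘ eta2 = eta1 ⊗ eta1].

Record is_Hopf_datum : Prop := HopfDatum {
  hd_algebra1 : is_algebra m1 eta1;
  hd_eps1 : is_augmentation m1 eta1 eps1;
  hd_coalgebra2 : is_coalgebra Delta2 eps2;
  hd_eta2 : is_coaugmentation Delta2 eps2 eta2;
  hd_nul : is_left_comodule Delta2 eps2 nu_l;
  hd_mur : is_right_module m1 eta1 mu_r;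
  hd_U1 : unitalU1;
  hd_U2 : unitalU2;
  hd_sigma_rho : unital_sigma_rho;
  hd_weak_assoc_m2 :
    m2 ∘ (m2 ⊗ id2) = m2 ∘ (mu_r ⊗ id2) ∘ (id2 ⊗ sigma_hat);
  hd_weak_coassoc_Delta1 :
    (id1 ⊗ Delta1) ∘ Delta1 = (rho_hat ⊗ id1) ∘ (id1 ⊗ nu_l) ∘ Delta1;
  hd_weak_assoc_mul :
    m1 ∘ (id1 ⊗ mu_l) ∘ (sigma_hat ⊗ id1)
    = m1 ∘ (id1 ⊗ sigma) ∘ (phi21 ⊗ id2) ∘ (id2 ⊗ phi21);
  hd_weak_coassoc_nur :
    (id2 ⊗ rho_hat) ∘ (nu_r ⊗ id2) ∘ Delta2
    = (phi12 ⊗ id1) ∘ (id1 ⊗ phi12) ∘ (rho ⊗ id2) ∘ Delta2;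
  hd_module_algebra_mul :
    mu_l ∘ (id2 ⊗ m1) = m1 ∘ (id1 ⊗ mu_l) ∘ (phi21 ⊗ id1);
  hd_module_algebra_mur :
    mu_r ∘ (m2 ⊗ id1) = m2 ∘ (mu_r ⊗ id2) ∘ (id2 ⊗ phi21);
  hd_comodule_coalgebra_nul :
    (id2 ⊗ Delta1) ∘ nu_l = (phi12 ⊗ id1) ∘ (id1 ⊗ nu_l) ∘ Delta1;
  hd_comodule_coalgebra_nur :
    (Delta2 ⊗ id1) ∘ nu_r = (id2 ⊗ phi12) ∘ (nu_r ⊗ id2) ∘ Delta2;
  hd_cocycle :
    m1 ∘ (id1 ⊗ sigma) ∘ (sigma_hat ⊗ id2)
    = m1 ∘ (id1 ⊗ sigma) ∘ (phi21 ⊗ id2) ∘ (id2 ⊗ sigma_hat);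
  hd_cycle :
    (id1 ⊗ rho_hat) ∘ (rho ⊗ id2) ∘ Delta2
    = (rho_hat ⊗ id1) ∘ (id1 ⊗ phi12) ∘ (rho ⊗ id2) ∘ Delta2;
  hd_algebra_coalgebra1 :
    Delta1 ∘ m1
    = (lambda ⊗ m1) ∘ (id12 ⊗ Ψ[[:: B1], [:: B1]] ⊗ id1) ∘ (zeta ⊗ Delta1);
  hd_algebra_coalgebra2 :
    Delta2 ∘ m2
    = (m2 ⊗ alpha) ∘ (id2 ⊗ Ψ[[:: B2], [:: B2]] ⊗ id12) ∘ (Delta2 ⊗ beta);
  hd_module_coalgebra1 :
    rho_hat ∘ phi21
    = (kappa ⊗ lambda) ∘ (id12 ⊗ Theta ⊗ id1) ∘ (omega ⊗ zeta);
  hd_module_coalgebra2 :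
    Delta2 ∘ mu_r
    = (alpha ⊗ mu_r) ∘ (id2 ⊗ Ψ[[:: B2], [:: B1; B2]] ⊗ id1)
        ∘ (Delta2 ⊗ zeta);
  hd_comodule_algebra1 :
    nu_l ∘ m1
    = (alpha ⊗ m1) ∘ (id2 ⊗ Ψ[[:: B1], [:: B1; B2]] ⊗ id1) ∘ (nu_l ⊗ zeta);
  hd_comodule_algebra2 :
    phi12 ∘ sigma_hat
    = (alpha ⊗ kappa) ∘ (id2 ⊗ Theta ⊗ id12) ∘ (beta ⊗ omega);
  hd_module_comodule :
    phi12 ∘ phi21
    = (alpha ⊗ lambda) ∘ (id2 ⊗ Theta ⊗ id1) ∘ (beta ⊗ zeta);
  hd_cycle_cocycle :
    rho_hat ∘ sigma_hat
    = (kappa ⊗ kappa) ∘ (id12 ⊗ Theta ⊗ id12) ∘ (omega ⊗ omega) }.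

End HopfData.

(* Main.v *)
From mathcomp Require Import all_boot.
From mathcomp Require Import zify.
From Stdlib Require Import Eqdep.
Require Import Defs.

(** Write P = B1 ⊗ B2 for the cross product bialgebra, i1 = id ⊗ η2 and
    i2 = η1 ⊗ id for the inclusions of B1 and B2 into P, and p1 = id ⊗ ε2,
    p2 = ε1 ⊗ id for its projections.  The unit and counit laws of P and the
    (co)unital identities determine all components of the structure of P:
    - the products m (i_k ⊗ i_l) are i1 m1, φ21 and σ̂ for (k,l) = (1,1), (2,1)
      and (2,2) (mulP_11, mulP_21, mulP_22), and dually the components
      (p_i ⊗ p_j) Δ are ρ̂, φ12 and Δ2 p2 (comulP_11, comulP_21, comulP_22);
    - p1 m = κ and p2 m = ε1 ⊗ α (mulP_proj1, mulP_proj2), and dually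
      Δ i1 = ζ ⊗ η2 and Δ i2 = ω (comulP_inj1, comulP_inj2).

    Every compatibility of a Hopf datum is then a component of an axiom of P.
    Associativity of m, restricted along (i2,i1,i1), (i2,i2,i1) or (i2,i2,i2)
    and projected by p1 or p2, gives the six conditions on m2, μ_l, μ_r and σ;
    coassociativity of Δ gives the six conditions on Δ1, ν_l, ν_r and ρ; and
    multiplicativity of Δ, restricted along (i_k,i_l) and projected by
    (p_i,p_j), gives the eight remaining ones.  In two of these the computation
    ends with κ in place of λ, or with ω in place of β, on one side of a
    braiding.  The two identities that single out cocycle cross product
    bialgebras equate exactly these expressions in the absence of the braiding,
    and the inverse braiding transports them across it (eq_under_braid).

    Each step is an equality of string diagrams, true up to sliding independent
    boxes past each other after rewriting with known equalities.  These are
    proved by reflection: a diagram becomes a list of boxes with horizontal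
    positions, on which rewriting modulo sliding is a computation (provesP,
    used through the tactic diagram).  The transports along equalities of
    objects are absorbed beforehand by comparing morphisms together with their
    source and target (pack). *)

Set Implicit Arguments.
Unset Strict Implicit.
Unset Printing Implicit Defensive.
Local Open Scope scat_scope.

(** * Morphisms up to transport of source and target *)

Section Packed.
Variable C : smcat.

(** Equality of packed morphisms is equality up to transport: it relates
    morphisms whose types agree only propositionally, and castHom becomes
    invisible to it. *)
Definition pack (A B : C) (f : Hom A B) : {X : C & {Y : C & Hom X Y}} :=
  existT _ A (existT _ B f).

(** This is uniqueness of identity proofs for objects: a transport along any
    equality A = A is the identity. *)
Lemma pack_inj (A B : C) (f g : Hom A B) : pack f = pack g -> f = g.
Proof.
by move=> E; apply: EqdepTheory.inj_pair2 (EqdepTheory.inj_pair2 _ _ _ _ _ E).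
Qed.

Lemma pack_castHom (A A' B B' : C) (eA : A = A') (eB : B = B') (f : Hom A B) :
  pack (castHom eA eB f) = pack f.
Proof. by case: A' / eA; case: B' / eB. Qed.

Lemma packP (A A' B B' : C) (f : Hom A B) (g : Hom A' B') :
  pack f = pack g -> exists (eA : A = A') (eB : B = B'), g = castHom eA eB f.
Proof.
move=> E; pose p := pack g.
have: exists (eA : A = projT1 p) (eB : B = projT1 (projT2 p)),
  projT2 (projT2 p) = castHom eA eB f.
  by rewrite /p -E; exists erefl, erefl.
by [].
Qed.

Lemma pack_compm (A B D A' B' D' : C) (g : Hom B D) (f : Hom A B)
    (g' : Hom B' D') (f' : Hom A' B') :
  pack g = pack g' -> pack f = pack f' -> pack (compm g f) = pack (compm g' f').
Proof.
move=> /packP[eB [eD ->]] /packP[eA [eB' ->]].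
case: D' / eD g'; case: A' / eA f'; case: B' / eB eB' => eB' _ _.
by rewrite (EqdepTheory.UIP_refl _ _ eB').
Qed.

Lemma pack_tensf (A B D E A' B' D' E' : C) (f : Hom A B) (g : Hom D E)
    (f' : Hom A' B') (g' : Hom D' E') :
  pack f = pack f' -> pack g = pack g' -> pack (tensf f g) = pack (tensf f' g').
Proof.
move=> /packP[eA [eB ->]] /packP[eD [eE ->]].
by case: A' / eA f'; case: B' / eB; case: D' / eD g'; case: E' / eE.
Qed.

Lemma pack_tensw (s s' t t' : seq C) (f : mor s s') (g : mor t t') :
  pack (f ⊗ g) = pack (tensf f g).
Proof. exact: pack_castHom. Qed.

Lemma pack_comp (s t u s' t' u' : seq C) (g : mor t u) (f : mor s t)
    (g' : mor t' u') (f' : mor s' t') :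
  pack g = pack g' -> pack f = pack f' -> pack (g ∘ f) = pack (g' ∘ f').
Proof. exact: pack_compm. Qed.

Lemma pack_tens (s s' t t' u u' v v' : seq C) (f : mor s s') (g : mor t t')
    (f' : mor u u') (g' : mor v v') :
  pack f = pack f' -> pack g = pack g' -> pack (f ⊗ g) = pack (f' ⊗ g').
Proof. by rewrite !pack_tensw; apply: pack_tensf. Qed.

Lemma tensw_comp (s s' s'' t t' t'' : seq C) (f' : mor s' s'') (f : mor s s')
    (g' : mor t' t'') (g : mor t t') :
  (f' ∘ f) ⊗ (g' ∘ g) = (f' ⊗ g') ∘ (f ⊗ g).
Proof.
apply: pack_inj; rewrite pack_tensw tensf_comp.
by apply: pack_compm; rewrite pack_tensw.
Qed.

Lemma tensw_id (s t : seq C) : idw s ⊗ idw t = idw (s ++ t).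
Proof.
apply: pack_inj; rewrite pack_tensw tensf_id.
by rewrite /idw -(prodw_cat s t).
Qed.

(** The two sides live over differently bracketed words, so associativity can
    only be stated for packed morphisms. *)
Lemma tenswA (s s' t t' u u' : seq C) (f : mor s s') (g : mor t t')
    (h : mor u u') : pack (f ⊗ (g ⊗ h)) = pack ((f ⊗ g) ⊗ h).
Proof.
rewrite !pack_tensw.
transitivity (pack (tensf f (tensf g h))).
  by apply: pack_tensf; rewrite ?pack_tensw.
transitivity (pack (tensf (tensf f g) h)).
  by rewrite -tensfA pack_castHom.
by apply: pack_tensf; rewrite ?pack_tensw.
Qed.

Lemma tens1w (s s' : seq C) (f : mor s s') : idw [::] ⊗ f = f.
Proof. by apply: pack_inj; rewrite pack_tensw -{2}(tens1f f) pack_castHom. Qed.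

Lemma tensw1 (s s' : seq C) (f : mor s s') : pack (f ⊗ idw [::]) = pack f.
Proof. by rewrite pack_tensw -{2}(tensf1 f) pack_castHom. Qed.

Lemma compwA (s t u v : seq C) (h : mor u v) (g : mor t u) (f : mor s t) :
  h ∘ (g ∘ f) = h ∘ g ∘ f.
Proof. exact: compmA. Qed.

Lemma comp1w (s t : seq C) (f : mor s t) : idw t ∘ f = f.
Proof. exact: compm1f. Qed.

Lemma compw1 (s t : seq C) (f : mor s t) : f ∘ idw s = f.
Proof. exact: compmf1. Qed.

(** Unlike castHom, this moves along equalities of words: equal objects may
    come from different words. *)
Definition castw (s s' t t' : seq C) (es : s = s') (et : t = t')
    (f : mor s t) : mor s' t' :=
  castHom (congr1 (@prodw C) es) (congr1 (@prodw C) et) f.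

Lemma pack_castw (s s' t t' : seq C) (es : s = s') (et : t = t')
  (f : mor s t) : pack (castw es et f) = pack f.
Proof. exact: pack_castHom. Qed.

End Packed.

(** * String diagrams as lists of layers *)

Section Layers.
Variable C : smcat.

(** A box of a string diagram; its wires are labelled by objects. *)
Record gen := Gen { gdom : seq C; gcod : seq C; gmor : mor gdom gcod }.

Definition unit_gen : gen := Gen (idw [::]).

Variable env : seq gen.

Local Notation "'dm' i" := (gdom (nth unit_gen env i)) (at level 10, i at level 8).
Local Notation "'cd' i" := (gcod (nth unit_gen env i)) (at level 10, i at level 8).
Local Notation "'gm' i" := (gmor (nth unit_gen env i)) (at level 10, i at level 8).

(** (k, i) stands for the i-th box of the environment, with k wires to its
    left. *)
Definition layer : Type := nat * nat.

Definition slice (u : seq C) (i : nat) (v : seq C) :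
    mor (u ++ dm i ++ v) (u ++ cd i ++ v) :=
  idw u ⊗ (gm i ⊗ idw v).

(** A list of layers, first layer applied first, determines a morphism once the
    source word is given (denotes_inj).  This is a relation and not a function
    because whether the boxes fit the wires is a question of equality of
    objects, which is not decidable. *)
Fixpoint denotes (w w' : seq C) (L : seq layer) (f : mor w w') : Prop :=
  match L with
  | [::] => w = w' /\ pack f = pack (idw w)
  | (k, i) :: L' => exists u v (f' : mor (u ++ cd i ++ v) w'),
      [/\ size u = k, w = u ++ dm i ++ v, denotes L' f'
        & pack f = pack (f' ∘ slice u i v)]
  end.

Lemma cat_eq_size (T : Type) (u u' v v' : seq T) :
  size u = size u' -> u ++ v = u' ++ v' -> u = u' /\ v = v'.
Proof.
move=> Es E; split.
  by rewrite -(take_size_cat v (erefl (size u))) E Es take_size_cat.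
by rewrite -(drop_size_cat v (erefl (size u))) E Es drop_size_cat.
Qed.

Lemma denotes_cast w1 w1' w2 w2' L (f1 : mor w1 w1') (f2 : mor w2 w2') :
  w1 = w2 -> w1' = w2' -> pack f1 = pack f2 -> denotes L f1 -> denotes L f2.
Proof. by move=> e e'; subst=> /pack_inj ->. Qed.

Lemma denotes_inj w1 w1' w2 w2' L (f1 : mor w1 w1') (f2 : mor w2 w2') :
  w1 = w2 -> denotes L f1 -> denotes L f2 -> w1' = w2' /\ pack f1 = pack f2.
Proof.
move=> e; subst w2; elim: L w1 f1 f2 => [|[k i] L IHL] w f1 f2 /=.
  by move=> [e1 ->] [e2 ->]; split; first congruence.
move=> [u [v [f [su ew df ->]]]] [u2 [v2 [f' [su' ew' df' ->]]]].
rewrite -su' in su; rewrite ew in ew'.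
have [eu /cat_eq_size[]// _ ev] := cat_eq_size su ew'.
subst u2 v2; have [e Ef] := IHL _ f f' df df'.
by split=> //; apply: pack_comp.
Qed.

Lemma denotes_comp w w' w'' L L' (f : mor w w') (g : mor w' w'') :
  denotes L f -> denotes L' g -> denotes (L ++ L') (g ∘ f).
Proof.
elim: L w f => [|[k i] L IHL] w f /=.
  by move=> [e]; subst w' => /pack_inj ->; rewrite compw1.
move=> [u [v [f' [su ew df Ef]]]] dg; exists u, v, (g ∘ f'); split=> //.
  exact: IHL.
by subst w; rewrite (pack_inj Ef) compwA.
Qed.

Lemma cat_eq_leq (T : Type) (u u' v v' : seq T) :
  u ++ v = u' ++ v' -> size u <= size u' ->
  exists m, u' = u ++ m /\ v = m ++ v'.
Proof.
elim: u u' => [|x u IHu] u' /=; first by move=> -> _; exists u'.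
by case: u' => // y u' [<- /IHu E] /E [m [-> ->]]; exists m.
Qed.

Definition shift (k : nat) (L : seq layer) : seq layer :=
  [seq (k + l.1, l.2) | l <- L].

Lemma slice_cat a u i v b :
  pack (slice (a ++ u) i (v ++ b)) = pack (idw a ⊗ (slice u i v ⊗ idw b)).
Proof.
rewrite /slice -!tensw_id -!tenswA.
by do !(apply: pack_tens => //; rewrite ?tenswA -?tenswA).
Qed.

(** Adding idle wires on the left shifts the boxes, and adding them on the right
    changes nothing. *)
Lemma denotes_whisker w w' L (f : mor w w') u v :
  denotes L f -> denotes (shift (size u) L) (idw u ⊗ (f ⊗ idw v)).
Proof.
elim: L w f => [|[k i] L IHL] w f /=.
  by move=> [e]; subst w' => /pack_inj ->; rewrite !tensw_id.
move=> [a [b [f' [sa ew df Ef]]]].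
have e : u ++ (a ++ cd i ++ b) ++ v = (u ++ a) ++ cd i ++ b ++ v.
  by rewrite !catA.
exists (u ++ a), (b ++ v), (castw e erefl (idw u ⊗ (f' ⊗ idw v))).
rewrite size_cat sa; split=> //; first by rewrite ew !catA.
  by apply: denotes_cast (IHL _ _ df) => //; rewrite pack_castw.
subst w; rewrite (pack_inj Ef).
transitivity (pack ((idw u ⊗ (f' ⊗ idw v)) ∘ (idw u ⊗ (slice a i b ⊗ idw v)))).
  by rewrite -!tensw_comp !comp1w.
apply: pack_comp; first by rewrite pack_castw.
by rewrite slice_cat.
Qed.

Definition step (w : seq C) (l : layer) : seq C :=
  take l.1 w ++ cd l.2 ++ drop (l.1 + size (dm l.2)) w.

(** The target word of the diagram L with source w, if the boxes of L fit. *)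
Definition target (w : seq C) (L : seq layer) : seq C := foldl step w L.

Lemma step_cat u i v : step (u ++ dm i ++ v) (size u, i) = u ++ cd i ++ v.
Proof.
by rewrite /step /= take_size_cat // -size_cat [in drop _ _]catA drop_size_cat.
Qed.

Lemma denotes_target w w' L (f : mor w w') : denotes L f -> w' = target w L.
Proof.
elim: L w f => [|[k i] L IHL] w f /=; first by case.
move=> [u [v [f' [<- ew df _]]]]; rewrite ew step_cat; exact: IHL df.
Qed.

Lemma denotes_split w w' L L' (f : mor w w') : denotes (L ++ L') f ->
  exists wm (f1 : mor w wm) (f2 : mor wm w'),
  [/\ denotes L f1, denotes L' f2 & f = f2 ∘ f1].
Proof.
elim: L w f => [|[k i] L IHL] w f /=.
  by move=> df; exists w, (idw w), f; split; rewrite ?compw1.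
move=> [u [v [f' [su ew /IHL [wm [f1 [f2 [d1 d2 Ef']]]] Ef]]]].
subst w; exists wm, (f1 ∘ slice u i v), f2; split=> //.
  by exists u, v, f1.
by rewrite (pack_inj Ef) Ef' compwA.
Qed.

(** Only this implication between lists of layers is tracked, as uniqueness of
    denotation turns it into an equality of morphisms. *)
Definition entails (w : seq C) (L L' : seq layer) : Prop :=
  forall w' (f : mor w w'), denotes L f -> denotes L' f.

Lemma entails_cons w l L L' :
  (forall w1, entails w1 L L') -> entails w (l :: L) (l :: L').
Proof.
case: l => k i E w' f /= [u [v [f' [su ew df Ef]]]].
by exists u, v, f'; split=> //; apply: E.
Qed.

(** Two boxes side by side can be applied one after the other, in either order;
    the next lemma is the other order. *)
Lemma slices_right u i m j v :
  pack (idw u ⊗ (gm i ⊗ (idw m ⊗ (gm j ⊗ idw v)))) =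
  pack (idw u ⊗ (idw (cd i) ⊗ (idw m ⊗ (gm j ⊗ idw v)))
        ∘ slice u i (m ++ dm j ++ v)).
Proof. by rewrite /slice -!tensw_comp !comp1w compw1. Qed.

Lemma slices_left u i m j v :
  pack (idw u ⊗ (gm i ⊗ (idw m ⊗ (gm j ⊗ idw v)))) =
  pack (slice u i (m ++ cd j ++ v)
        ∘ (idw u ⊗ (idw (dm i) ⊗ (idw m ⊗ (gm j ⊗ idw v))))).
Proof. by rewrite /slice -!tensw_id -!tensw_comp !comp1w compw1. Qed.

Lemma slice_nest u s m j v :
  pack (slice (u ++ s ++ m) j v) =
  pack (idw u ⊗ (idw s ⊗ (idw m ⊗ (gm j ⊗ idw v)))).
Proof.
rewrite /slice -!tensw_id -!tenswA.
by do !(apply: pack_tens=> //; rewrite -?tenswA).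
Qed.

(** The interchange law for adjacent layers when the second box lies to the
    right of the wires that the first one produces.  Moving it first changes its
    position by the difference between the numbers of outputs and inputs of the
    first box. *)
Lemma swap_right w k i l j L : k + size (cd i) <= l ->
  entails w ((k, i) :: (l, j) :: L)
    ((l - size (cd i) + size (dm i), j) :: (k, i) :: L).
Proof.
move=> le_kl w' f /= [u [v [f1 [su ew [u2 [v2 [f2 [su2 ew2 df2 Ef1]]]] Ef]]]].
have [||m [eu ev]] := @cat_eq_leq _ (u ++ cd i) u2 v (dm j ++ v2).
- by rewrite -catA.
- by rewrite size_cat su su2.
rewrite -catA in eu.
subst u2 v w.
have e1 : (u ++ cd i ++ m) ++ cd j ++ v2 = u ++ cd i ++ (m ++ cd j ++ v2).
  by rewrite !catA.
have e2 : u ++ dm i ++ (m ++ cd j ++ v2) = (u ++ dm i ++ m) ++ cd j ++ v2.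
  by rewrite !catA.
pose f2' := castw e1 erefl f2.
exists (u ++ dm i ++ m), v2, (castw e2 erefl (f2' ∘ slice u i (m ++ cd j ++ v2))).
split; [by rewrite !size_cat su -su2 !size_cat -su; lia | by rewrite !catA | |].
  exists u, (m ++ cd j ++ v2), f2'; split=> //; last by rewrite pack_castw.
  by apply: denotes_cast df2 => //; rewrite pack_castw.
rewrite Ef.
transitivity (pack (f2' ∘ (idw u ⊗ (gm i ⊗ (idw m ⊗ (gm j ⊗ idw v2)))))).
  rewrite (pack_inj (slices_right _ _ _ _ _)) compwA; apply: pack_comp => //.
  rewrite Ef1; apply: pack_comp; first by rewrite pack_castw.
  exact: slice_nest.
rewrite (pack_inj (slices_left _ _ _ _ _)) compwA; apply: pack_comp.
  by rewrite pack_castw.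
by rewrite slice_nest.
Qed.

Lemma swap_left w k i l j L : l + size (dm j) <= k ->
  entails w ((k, i) :: (l, j) :: L)
    ((l, j) :: (k - size (dm j) + size (cd j), i) :: L).
Proof.
move=> le_lk w' f /= [v [u [f1 [sv ew [v2 [u2 [f2 [sv2 ew2 df2 Ef1]]]] Ef]]]].
have [||m [ev eu]] := @cat_eq_leq _ (v2 ++ dm j) v u2 (cd i ++ u).
- by rewrite -catA.
- by rewrite size_cat sv sv2.
rewrite -catA in ev; subst v u2 w.
have e1 : v2 ++ cd j ++ (m ++ cd i ++ u) = (v2 ++ cd j ++ m) ++ cd i ++ u.
  by rewrite !catA.
have e2 : (v2 ++ cd j ++ m) ++ dm i ++ u = v2 ++ cd j ++ (m ++ dm i ++ u).
  by rewrite !catA.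
pose f2' := castw e1 erefl f2.
exists v2, (m ++ dm i ++ u), (castw e2 erefl (f2' ∘ slice (v2 ++ cd j ++ m) i u)).
split=> //; first by rewrite !catA.
  exists (v2 ++ cd j ++ m), u, f2'; split=> //; last by rewrite pack_castw.
    by rewrite !size_cat sv2 -sv !size_cat sv2; lia.
  by apply: denotes_cast df2 => //; rewrite pack_castw.
rewrite Ef.
transitivity (pack (f2 ∘ (idw v2 ⊗ (gm j ⊗ (idw m ⊗ (gm i ⊗ idw u)))))).
  rewrite (pack_inj (slices_left _ _ _ _ _)) compwA; apply: pack_comp => //.
  by rewrite slice_nest.
rewrite (pack_inj (slices_right _ _ _ _ _)) compwA; apply: pack_comp => //.
by rewrite pack_castw; apply: pack_comp; rewrite ?pack_castw ?slice_nest.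
Qed.

(** Both exchanges are possible when a box without outputs meets a box without
    inputs, hence the list of results. *)
Definition swaps (x y : layer) : seq (layer * layer) :=
  let: (k, i) := x in let: (l, j) := y in
  (if k + size (cd i) <= l
   then [:: ((l - size (cd i) + size (dm i), j), (k, i))] else [::]) ++
  (if l + size (dm j) <= k
   then [:: ((l, j), (k - size (dm j) + size (cd j), i))] else [::]).

(** The ways to slide y above all the layers of K, with the displaced K. *)
Fixpoint lifts (K : seq layer) (y : layer) : seq (layer * seq layer) :=
  if K is x :: K' then
    flatten [seq [seq (z.1, z.2 :: p.2) | z <- swaps x p.1] | p <- lifts K' y]
  else [:: (y, [::])].

(** The layers of L that can slide to the top of K ++ L, with what remains. *)
Fixpoint fronts (K L : seq layer) : seq (layer * seq layer) :=
  if L is y :: L' then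
    [seq (p.1, p.2 ++ L') | p <- lifts K y] ++ fronts (rcons K y) L'
  else [::].

(** Equality of diagrams up to sliding: the first layer of R must be among the
    layers that can come first in L. *)
Fixpoint interchangeable (L R : seq layer) : bool :=
  if R is r :: R' then
    has (fun p => (p.1 == r) && interchangeable p.2 R') (fronts [::] L)
  else nilp L.

Lemma swapsP w x y z L : z \in swaps x y ->
  entails w (x :: y :: L) (z.1 :: z.2 :: L).
Proof.
case: x y => k i [l j]; rewrite mem_cat => /orP[].
  by case: ifP => // le; rewrite inE => /eqP->; apply: swap_right.
by case: ifP => // le; rewrite inE => /eqP->; apply: swap_left.
Qed.

Lemma liftsP K y p : p \in lifts K y ->
  forall w L, entails w (K ++ y :: L) (p.1 :: p.2 ++ L).
Proof.
elim: K p => [|x K IHK] p /=; first by rewrite inE => /eqP-> w L w' f d; exact: d.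
move=> /flatten_mapP[q /IHK lq /mapP[z zin ->]] w L w' f /= d.
apply: swapsP zin _ _ _.
by apply: entails_cons d => w1; apply: lq.
Qed.

Lemma frontsP K L p : p \in fronts K L ->
  forall w, entails w (K ++ L) (p.1 :: p.2).
Proof.
elim: L K => //= y L IHL K; rewrite mem_cat => /orP[/mapP[q /liftsP lq ->]|].
  by move=> w; apply: lq.
by move/IHL; rewrite cat_rcons.
Qed.

Lemma interchangeableP L R :
  interchangeable L R -> forall w, entails w L R.
Proof.
elim: R L => [|r R IHR] L /=; first by move=> /nilP -> w w' f d; exact: d.
move=> /hasP[p /frontsP fp /andP[/eqP <- /IHR pR]] w w' f df.
have d := fp w w' f df.
by apply: entails_cons d.
Qed.

(** Boxes are named by their index in the environment, so that comparing them
    is a computation; words are kept as they are, so that the value of the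
    reification of a morphism is convertible to that morphism. *)
Inductive expr : seq C -> seq C -> Type :=
  | EAtom i : expr (dm i) (cd i)
  | EId s : expr s s
  | EComp s t u : expr t u -> expr s t -> expr s u
  | ETens s s' t t' : expr s s' -> expr t t' -> expr (s ++ t) (s' ++ t').

Fixpoint eval s t (e : expr s t) : mor s t :=
  match e with
  | EAtom i => gm i
  | EId s => idw s
  | EComp _ _ _ e1 e2 => eval e1 ∘ eval e2
  | ETens _ _ _ _ e1 e2 => eval e1 ⊗ eval e2
  end.

Fixpoint layers s t (e : expr s t) : seq layer :=
  match e with
  | EAtom i => [:: (0, i)]
  | EId s => [::]
  | EComp _ _ _ e1 e2 => layers e2 ++ layers e1
  | ETens _ s' _ _ e1 e2 => layers e1 ++ shift (size s') (layers e2)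
  end.

(** In f ⊗ g the layers of f come first, so those of g are shifted by the
    outputs of f. *)
Lemma denotes_layers s t (e : expr s t) : denotes (layers e) (eval e).
Proof.
elim: e => {s t} /= [i|s|s t u e1 d1 e2 d2|s s' t t' e1 d1 e2 d2].
- have e : cd i ++ [::] = cd i by rewrite cats0.
  exists [::], [::], (castw (esym e) erefl (idw (cd i))).
  split; rewrite ?pack_castw //=.
  - by rewrite cats0.
  - by rewrite cats0.
  rewrite -[gm i in LHS]comp1w; apply: pack_comp; first by rewrite pack_castw.
  by rewrite /slice tens1w tensw1.
- by split.
- exact: denotes_comp.
have -> : eval e1 ⊗ eval e2 = (idw s' ⊗ eval e2) ∘ (eval e1 ⊗ idw t).
  by rewrite -tensw_comp comp1w compw1.
apply: denotes_comp.
  have := denotes_whisker [::] t d1; rewrite tens1w.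
  by rewrite /shift map_id_in // => -[].
apply: denotes_cast (denotes_whisker s' [::] d2); rewrite ?cats0 //.
by apply: pack_tens => //; rewrite tensw1.
Qed.

(** The hypotheses on the target of L1 say that the source of the rewriting
    rule occurs at position k: the layers alone do not see the labels of the
    wires that pass through the rule untouched. *)
Lemma entails_rule w L1 L2 k s t (e e' : expr s t) :
  eval e = eval e' ->
  target w L1 = take k (target w L1) ++ s ++ drop (k + size s) (target w L1) ->
  k <= size (target w L1) ->
  entails w (L1 ++ shift k (layers e) ++ L2) (L1 ++ shift k (layers e') ++ L2).
Proof.
move=> Ee; set w1 := target w L1; set u := take k w1; set v := drop _ _.
move=> ew le_k w' f /denotes_split[wm [f1 [f2 [d1 d2 ->]]]].
have em : wm = u ++ s ++ v by rewrite -ew; apply: denotes_target d1.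
have su : size u = k by rewrite size_takel.
subst wm; have [wn [f3 [f4 [d3 d4 ->]]]] := denotes_split d2.
have d3' := denotes_whisker u v (denotes_layers e); rewrite su in d3'.
have [en E3] := denotes_inj erefl d3 d3'; subst wn.
apply: denotes_comp => //; apply: denotes_comp => //.
rewrite (pack_inj E3) Ee -su; exact: denotes_whisker (denotes_layers e').
Qed.

Fixpoint first_some (T U : Type) (f : T -> option U) (s : seq T) : option U :=
  if s is x :: s' then
    if f x is Some y then Some y else first_some f s'
  else None.

(** Completes an occurrence of the left-hand side of a rule.  The diagram is
    pre ++ B ++ D ++ rest, where B is the part of the occurrence found so far,
    need is the rest of the left-hand side, and D holds the layers that must
    stay below B.  The next layer x joins B if it matches, is moved to pre if it
    can slide above B, and goes to D otherwise.  The first box of B sits at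
    position o in the rule.  As the answer is validated by interchangeable, the
    correctness of the search itself does not matter. *)
Fixpoint embed (o : nat) (pre B D need rest : seq layer) {struct rest}
    : option (seq layer * nat * seq layer) :=
  let base := (head (0, 0) B).1 - o in
  if nilp need then Some (pre, base, D ++ rest) else
  if rest is x :: rest' then
    let matched := first_some (fun p : layer * seq layer =>
      first_some (fun r : layer * seq layer =>
        if (p.1.1 + o == (head (0, 0) B).1 + r.1.1) && (p.1.2 == r.1.2)
        then embed o pre (rcons B p.1) p.2 r.2 rest' else None)
      (fronts [::] need)) (lifts D x) in
    if matched is Some res then Some res else
    let lifted := [seq (q, p.2) | p <- lifts D x, q <- lifts B p.1] in
    if lifted is (q, D') :: _ then embed o (rcons pre q.1) q.2 D' need rest'
    else embed o pre B (rcons D x) need rest'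
  else None.

Fixpoint locate (lx pre rest : seq layer) : option (seq layer * nat * seq layer) :=
  if rest is x :: rest' then
    let found := first_some (fun r : layer * seq layer =>
      if x.2 == r.1.2
      then embed r.1.1 pre [:: x] [::] r.2 rest' else None) (fronts [::] lx) in
    if found is Some res then Some res else locate lx (rcons pre x) rest'
  else None.

Record rule := Rule { rsrc; rtgt; rlhs : expr rsrc rtgt; rrhs : expr rsrc rtgt }.

Definition valid_rule (r : rule) : Prop := eval (rlhs r) = eval (rrhs r).

(** Applies each rule once, in the given order.  The typing conditions are
    returned as a proposition, since equality of objects is not decidable; on
    explicit words they hold by reflexivity. *)
Fixpoint rewrites (w : seq C) (rs : seq rule) (L : seq layer)
    : option (seq layer * Prop) :=
  if rs is r :: rs' then
    if locate (layers (rlhs r)) [::] L is Some (L1, k, L2) then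
      let w1 := target w L1 in
      if interchangeable L (L1 ++ shift k (layers (rlhs r)) ++ L2)
         && (k <= size w1) then
        if rewrites w rs' (L1 ++ shift k (layers (rrhs r)) ++ L2)
          is Some (L', P)
        then Some (L', w1 = take k w1 ++ rsrc r ++ drop (k + size (rsrc r)) w1
                       /\ P)
        else None
      else None
    else None
  else Some (L, True).

Fixpoint valid_rules (rs : seq rule) : Prop :=
  if rs is r :: rs' then valid_rule r /\ valid_rules rs' else True.

Lemma rewritesP w rs L L' P : valid_rules rs ->
  rewrites w rs L = Some (L', P) -> P -> entails w L L'.
Proof.
elim: rs L L' P => [|r rs IHrs] L L' P /=.
  by move=> _ [<- _] _ w' f d; exact: d.
move=> [vr vrs]; case: locate => // -[[L1 k] L2].
case: ifP => // /andP[/interchangeableP inter le_k].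
case E: rewrites => [[L'' Q]|] // [<- <-] [ew q] w' f /inter d.
have d2 := entails_rule vr ew le_k d.
exact: (IHrs _ _ _ vrs E q _ _ d2).
Qed.

(** The left-hand side is rewritten with ls and the right-hand side with rs,
    and the results are compared. *)
Definition proves s t (ls rs : seq rule) (e e' : expr s t) : Prop :=
  if rewrites s ls (layers e) is Some (L, P) then
    if rewrites s rs (layers e') is Some (R, Q) then
      interchangeable L R /\ P /\ Q
    else False
  else False.

Lemma provesP s t ls rs (e e' : expr s t) :
  valid_rules ls -> valid_rules rs -> proves ls rs e e' -> eval e = eval e'.
Proof.
rewrite /proves => vl vr.
case El: rewrites => [[L P]|] //; case Er: rewrites => [[R Q]|] //.
move=> [/interchangeableP LR [p q]].
have dl := LR _ _ _ (rewritesP vl El p (denotes_layers e)).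
have dr := rewritesP vr Er q (denotes_layers e').
by have [_ /pack_inj] := denotes_inj erefl dl dr.
Qed.

End Layers.

(** * The tactic for equalities of diagrams *)

(** The environment collects the subterms that are not compositions, tensor
    products or identities, compared syntactically. *)
Ltac mem_atom x env :=
  lazymatch env with
  | nil => false
  | cons (@Gen _ _ _ ?y) ?env' =>
    match constr:(tt) with
    | _ => let _ := match constr:(tt) with _ => constr_eq x y end in true
    | _ => mem_atom x env'
    end
  end.

Ltac add_atoms f env :=
  lazymatch f with
  | compw ?g ?h => let env' := add_atoms g env in add_atoms h env'
  | tensw ?g ?h => let env' := add_atoms g env in add_atoms h env'
  | idw _ => env
  | _ => lazymatch mem_atom f env with
         | true => env
         | false => constr:(cons (Gen f) env)
         end
  end.

(** Rules are given as nested pairs of equations, tt being the empty list. *)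
Ltac add_rules ls env :=
  lazymatch ls with
  | tt => env
  | (?ls', ?E) => let env' := add_rules ls' env in add_rules E env'
  | ?E => lazymatch type of E with
          | ?x = ?y => let env' := add_atoms x env in add_atoms y env'
          end
  end.

Ltac atom_index x env :=
  lazymatch env with
  | cons (@Gen _ _ _ ?y) ?env' =>
    match constr:(tt) with
    | _ => let _ := match constr:(tt) with _ => constr_eq x y end in constr:(0)
    | _ => let n := atom_index x env' in constr:(S n)
    end
  end.

Ltac reify f env ev :=
  lazymatch f with
  | @compw ?C ?s ?t ?u ?g ?h =>
    let a := reify g env ev in let b := reify h env ev in
    constr:(@EComp C ev s t u a b)
  | @tensw ?C ?s ?s' ?t ?t' ?g ?h =>
    let a := reify g env ev in let b := reify h env ev in
    constr:(@ETens C ev s s' t t' a b)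
  | @idw ?C ?s => constr:(@EId C ev s)
  | _ => let i := atom_index f env in constr:(EAtom ev i)
  end.

Ltac reify_rules C ls env ev acc :=
  lazymatch ls with
  | tt => acc
  | (?ls', ?E) =>
    let acc' := reify_rules C E env ev acc in reify_rules C ls' env ev acc'
  | ?E => lazymatch type of E with
          | @eq (@mor _ ?s ?t) ?x ?y =>
            let a := reify x env ev in let b := reify y env ev in
            lazymatch acc with
            | (?rs, ?prf) => constr:((cons (@Rule C ev s t a b) rs, conj E prf))
            end
          end
  end.

Ltac diagram_core ls rs :=
  lazymatch goal with
  | |- @eq (@mor ?C ?s ?t) ?x ?y =>
    let env0 := constr:(@nil (gen C)) in
    let env1 := add_rules ls env0 in
    let env2 := add_rules rs env1 in
    let env3 := add_atoms x env2 in
    let env := add_atoms y env3 in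
    let ev := fresh "ev" in
    pose (ev := env);
    let a := reify x env ev in
    let b := reify y env ev in
    let l0 := constr:((@nil (@rule C ev), I)) in
    let l := reify_rules C ls env ev l0 in
    let r := reify_rules C rs env ev l0 in
    lazymatch l with
    | (?l1, ?lp) =>
      lazymatch r with
      | (?r1, ?rp) =>
        refine (@provesP C ev s t l1 r1 a b lp rp _);
        solve [vm_compute; repeat split]
      end
    end
  end.

(** [diagram (E1, .., En) with (F1, .., Fm)] proves an equality of diagrams by
    rewriting its left-hand side with E1, .., En and its right-hand side with
    F1, .., Fm, in this order and once with each, up to interchange. *)
Tactic Notation "diagram" := diagram_core tt tt.
Tactic Notation "diagram" constr(ls) := diagram_core ls tt.
Tactic Notation "diagram" constr(ls) "with" constr(rs) :=
  diagram_core ls rs.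

(** * Braidings of words *)

Lemma pack_braidw (C : sbmcat) (s t : seq C) :
  pack Ψ[s, t] = pack (braid (prodw s) (prodw t)).
Proof. exact: pack_castHom. Qed.

Ltac pack_congr :=
  lazymatch goal with
  | |- pack (compw ?g ?f) = pack (compw ?g' ?f') =>
    refine (pack_comp (g := g) (f := f) (g' := g') (f' := f') _ _); pack_congr
  | |- pack (tensw ?f ?g) = pack (tensw ?f' ?g') =>
    refine (pack_tens (f := f) (g := g) (f' := f') (g' := g') _ _); pack_congr
  | |- _ => first [done | by rewrite pack_castHom | by rewrite !pack_braidw
                  | idtac]
  end.

Section Braid.
Variable C : sbmcat.

Lemma braidw_nat (s s' t t' : seq C) (f : mor s s') (g : mor t t') :
  Ψ[s', t'] ∘ (f ⊗ g) = (g ⊗ f) ∘ Ψ[s, t].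
Proof.
apply: pack_inj.
transitivity (pack (compm (braid (prodw s') (prodw t')) (tensf f g))).
  by apply: pack_compm; rewrite ?pack_braidw ?pack_tensw.
by rewrite -braid_nat; apply: pack_compm; rewrite ?pack_braidw ?pack_tensw.
Qed.

(** The hexagon, for the words s, t and u taken as single objects. *)
Lemma pack_braidw_cat (s t u : seq C) :
  pack Ψ[s, t ++ u] =
  pack ((idw [:: prodw t] ⊗ Ψ[[:: prodw s], [:: prodw u]])
        ∘ (Ψ[[:: prodw s], [:: prodw t]] ⊗ idw [:: prodw u])).
Proof.
rewrite pack_braidw -(prodw_cat t u).
have E X Y : Ψ[[:: X], [:: Y]] = (braid X Y : mor [:: X; Y] [:: Y; X]).
  by apply: pack_inj; rewrite pack_braidw.
rewrite !E.
have /(congr1 (@pack _ _ _)) := braid_hexr (prodw s) (prodw t) (prodw u).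
by rewrite pack_castHom.
Qed.

Lemma braidw_cat3 (X Y Z T : C) :
  Ψ[[:: X], [:: Y; Z; T]] =
  (idw [:: Y; Z] ⊗ Ψ[[:: X], [:: T]]) ∘ (Ψ[[:: X], [:: Y; Z]] ⊗ idw [:: T]).
Proof.
apply: pack_inj; rewrite (pack_braidw_cat [:: X] [:: Y; Z] [:: T]).
by pack_congr.
Qed.

Lemma braidw_cat2 (X Y T : C) :
  Ψ[[:: X], [:: Y; T]] =
  (idw [:: Y] ⊗ Ψ[[:: X], [:: T]]) ∘ (Ψ[[:: X], [:: Y]] ⊗ idw [:: T]).
Proof.
apply: pack_inj; rewrite (pack_braidw_cat [:: X] [:: Y] [:: T]).
by pack_congr.
Qed.

Definition braidVw (X Y : C) : mor [:: Y; X] [:: X; Y] := braid_inv X Y.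

Lemma braidwK (X Y : C) : braidVw X Y ∘ Ψ[[:: X], [:: Y]] = idw [:: X; Y].
Proof.
rewrite -[RHS]braidK; congr (_ ∘ _).
by apply: pack_inj; rewrite pack_braidw.
Qed.

(** The braiding with the unit object is idempotent, by the hexagon for
    1 ⊗ 1 = 1, and it is invertible. *)
Lemma braidw1 (X : C) : Ψ[[:: X], [::]] = idw [:: X].
Proof.
set b : mor [:: X] [:: X] := Ψ[[:: X], [::]].
have pb : pack b = pack (braid X unit_ob) by exact: pack_braidw [:: X] [::].
pose bX : mor [:: X; unit_ob] [:: unit_ob; X] := braid X unit_ob.
have bb : b ∘ b = b.
  apply: pack_inj; rewrite [RHS]pb -[in RHS](tens1o unit_ob).
  have /(congr1 (@pack _ _ _)) := braid_hexr X unit_ob unit_ob.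
  rewrite pack_castHom => ->.
  apply: pack_comp.
    by rewrite -[b]tens1w; apply: (pack_tens (f := idw [::]) (g := b)
      (f' := idw [:: unit_ob]) (g' := bX)).
  by rewrite -(tensw1 b); apply: (pack_tens (f := b) (g := idw [::])
    (f' := bX) (g' := idw [:: unit_ob])).
pose c : mor [:: X] [:: X] := castHom (tens1o X) (tenso1 X) (braid_inv X unit_ob).
have cb : c ∘ b = idw [:: X].
  apply: pack_inj.
  transitivity (pack (compm (braid_inv X unit_ob) (braid X unit_ob))).
    by apply: pack_compm; rewrite ?pack_castHom.
  by rewrite braidK /idw /= tenso1.
by rewrite -[b]comp1w -cb -compwA bb.
Qed.

Lemma braid1w (X : C) : Ψ[[::], [:: X]] = idw [:: X].
Proof.
set b : mor [:: X] [:: X] := Ψ[[::], [:: X]].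
have pb : pack b = pack (braid unit_ob X) by exact: pack_braidw [::] [:: X].
pose bX : mor [:: unit_ob; X] [:: X; unit_ob] := braid unit_ob X.
have bb : b ∘ b = b.
  apply: pack_inj; rewrite [RHS]pb -[in RHS](tens1o unit_ob).
  have /(congr1 (@pack _ _ _)) := braid_hexl unit_ob unit_ob X.
  rewrite pack_castHom => ->.
  apply: pack_comp.
    by rewrite -(tensw1 b); apply: (pack_tens (f := b) (g := idw [::])
      (f' := bX) (g' := idw [:: unit_ob])).
  by rewrite -[b]tens1w; apply: (pack_tens (f := idw [::]) (g := b)
    (f' := idw [:: unit_ob]) (g' := bX)).
pose c : mor [:: X] [:: X] := castHom (tenso1 X) (tens1o X) (braid_inv unit_ob X).
have cb : c ∘ b = idw [:: X].
  apply: pack_inj.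
  transitivity (pack (compm (braid_inv unit_ob X) (braid unit_ob X))).
    by apply: pack_compm; rewrite ?pack_castHom.
  by rewrite braidK /idw /= tens1o.
by rewrite -[b]comp1w -cb -compwA bb.
Qed.

Lemma braid_counitl (X Y : C) (e : mor [:: X] [::]) :
  (idw [:: Y] ⊗ e) ∘ Ψ[[:: X], [:: Y]] = e ⊗ idw [:: Y].
Proof.
have := braidw_nat e (idw [:: Y]); rewrite (braid1w Y) => <-.
exact: comp1w.
Qed.

Lemma braid_counitr (X Y : C) (e : mor [:: Y] [::]) :
  (e ⊗ idw [:: X]) ∘ Ψ[[:: X], [:: Y]] = idw [:: X] ⊗ e.
Proof.
have := braidw_nat (idw [:: X]) e; rewrite (braidw1 X) => <-.
exact: comp1w.
Qed.

Lemma braid_unitl (X Y : C) (e : mor [::] [:: X]) :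
  Ψ[[:: X], [:: Y]] ∘ (e ⊗ idw [:: Y]) = idw [:: Y] ⊗ e.
Proof.
have := braidw_nat e (idw [:: Y]); rewrite (braid1w Y) => ->.
exact: compw1.
Qed.

Lemma braid_unitr (X Y : C) (e : mor [::] [:: Y]) :
  Ψ[[:: X], [:: Y]] ∘ (idw [:: X] ⊗ e) = e ⊗ idw [:: X].
Proof.
have := braidw_nat (idw [:: X]) e; rewrite (braidw1 X) => ->.
exact: compw1.
Qed.

(** A wire X crosses between Y and the first outputs of K, but not over T, so
    the two sides of the hypothesis do not occur in those of the conclusion.
    Letting X cross over all outputs of K and then back over T by the inverse
    braiding changes nothing, and naturality moves the complete crossing above
    K, where it does not separate Y from K any more. *)
Lemma eq_under_braid (X Y Z T V W W1 W2 : C)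
    (F : mor [:: Y; W1; W2] [:: V]) (K : mor [:: Z] [:: W1; W2; T])
    (F' : mor [:: Y; W] [:: V]) (K' : mor [:: Z] [:: W; T]) :
  (F ⊗ idw [:: T]) ∘ (idw [:: Y] ⊗ K) = (F' ⊗ idw [:: T]) ∘ (idw [:: Y] ⊗ K') ->
  (F ⊗ idw [:: X; T]) ∘ (idw [:: Y] ⊗ Ψ[[:: X], [:: W1; W2]] ⊗ idw [:: T])
    ∘ (idw [:: Y; X] ⊗ K)
  = (F' ⊗ idw [:: X; T]) ∘ (idw [:: Y] ⊗ Ψ[[:: X], [:: W]] ⊗ idw [:: T])
    ∘ (idw [:: Y; X] ⊗ K').
Proof.
move=> E.
have nK : (K ⊗ idw [:: X]) ∘ Ψ[[:: X], [:: Z]] =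
    Ψ[[:: X], [:: W1; W2; T]] ∘ (idw [:: X] ⊗ K).
  exact: esym (braidw_nat (idw [:: X]) K).
have nK' : (K' ⊗ idw [:: X]) ∘ Ψ[[:: X], [:: Z]] =
    Ψ[[:: X], [:: W; T]] ∘ (idw [:: X] ⊗ K').
  exact: esym (braidw_nat (idw [:: X]) K').
(* X crosses Z first, and returns over T only at the end. *)
transitivity ((idw [:: V] ⊗ braidVw X T)
  ∘ (((F ⊗ idw [:: T]) ∘ (idw [:: Y] ⊗ K)) ⊗ idw [:: X])
  ∘ (idw [:: Y] ⊗ Ψ[[:: X], [:: Z]])).
  diagram tt with (nK, braidw_cat3 X W1 W2 T, braidwK X T).
rewrite E.
diagram (nK', braidw_cat2 X W T, braidwK X T).
Qed.

End Braid.

(** * The cocycle cross product bialgebra *)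

Section CocycleCrossProduct.
Variables (C : sbmcat) (B1 B2 : C) (D : structure_morphisms B1 B2).
Hypothesis H : is_cocycle_cross_product_bialgebra D.

Local Notation id1 := (idw [:: B1]).
Local Notation id2 := (idw [:: B2]).
Local Notation id12 := (idw [:: B1; B2]).
Local Notation m1 := (m1 D).
Local Notation eta1 := (eta1 D).
Local Notation Delta1 := (Delta1 D).
Local Notation eps1 := (eps1 D).
Local Notation m2 := (m2 D).
Local Notation eta2 := (eta2 D).
Local Notation Delta2 := (Delta2 D).
Local Notation eps2 := (eps2 D).
Local Notation mu_l := (mu_l D).
Local Notation mu_r := (mu_r D).
Local Notation nu_l := (nu_l D).
Local Notation nu_r := (nu_r D).
Local Notation rho := (rho D).
Local Notation sigma := (sigma D).
Local Notation alpha := (alpha D).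
Local Notation beta := (beta D).
Local Notation lambda := (lambda D).
Local Notation zeta := (zeta D).
Local Notation phi12 := (phi12 D).
Local Notation phi21 := (phi21 D).
Local Notation sigmah := (sigma_hat D).
Local Notation rhoh := (rho_hat D).
Local Notation kappa := (kappa D).
Local Notation omega := (omega D).
Local Notation Theta := (Theta B1 B2).
Local Notation B12 := (tens B1 B2).
Local Notation "'Ψ11'" := Ψ[[:: B1], [:: B1]].
Local Notation "'Ψ12'" := Ψ[[:: B1], [:: B2]].
Local Notation "'Ψ21'" := Ψ[[:: B2], [:: B1]].
Local Notation "'Ψ22'" := Ψ[[:: B2], [:: B2]].

(** The multiplication cp_mul of P = B1 ⊗ B2 before its words are regrouped, so
    that it can be composed with the structure morphisms; comulP is its
    analogue for cp_comul. *)
Definition mulP : mor [:: B1; B2; B1; B2] [:: B1; B2] :=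
  (m1 ⊗ id2) ∘ (m1 ⊗ sigmah) ∘ (id1 ⊗ phi21 ⊗ id2).

Definition comulP : mor [:: B1; B2] [:: B1; B2; B1; B2] :=
  (id1 ⊗ phi12 ⊗ id2) ∘ (rhoh ⊗ Delta2) ∘ (id1 ⊗ Delta2).

Lemma pack_cp_mul : pack (cp_mul m1 phi21 sigmah) = pack mulP.
Proof. exact: pack_castHom. Qed.

Lemma pack_cp_comul : pack (cp_comul Delta2 phi12 rhoh) = pack comulP.
Proof. exact: pack_castHom. Qed.

Local Hint Resolve pack_cp_mul pack_cp_comul : core.

(** The axioms of P are stated over the words in the single object P; the next
    lemmas spell them out over words in B1 and B2, where they are the same up
    to transport. *)
Lemma mulPA : mulP ∘ (mulP ⊗ id12) = mulP ∘ (id12 ⊗ mulP).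
Proof.
have [[_ _ [E _ _]] _ _] := ccpb_bialgebra H.
apply: pack_inj.
transitivity (pack (cp_mul m1 phi21 sigmah
  ∘ (cp_mul m1 phi21 sigmah ⊗ idw [:: B12]))).
  by apply: esym; pack_congr.
by rewrite E; pack_congr.
Qed.

Lemma comulPA : (comulP ⊗ id12) ∘ comulP = (id12 ⊗ comulP) ∘ comulP.
Proof.
have [_ [_ _ [E _ _]] _] := ccpb_bialgebra H.
apply: pack_inj.
transitivity (pack ((cp_comul Delta2 phi12 rhoh ⊗ idw [:: B12])
  ∘ cp_comul Delta2 phi12 rhoh)).
  by apply: esym; pack_congr.
by rewrite E; pack_congr.
Qed.

Lemma mulP1l : mulP ∘ (eta1 ⊗ eta2 ⊗ id12) = id12.
Proof.
have [[_ _ [_ E _]] _ _] := ccpb_bialgebra H.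
apply: pack_inj.
transitivity (pack (cp_mul m1 phi21 sigmah
  ∘ (cp_unit eta1 eta2 ⊗ idw [:: B12]))).
  by apply: esym; pack_congr.
by rewrite E.
Qed.

Lemma mulP1r : mulP ∘ (id12 ⊗ (eta1 ⊗ eta2)) = id12.
Proof.
have [[_ _ [_ _ E]] _ _] := ccpb_bialgebra H.
apply: pack_inj.
transitivity (pack (cp_mul m1 phi21 sigmah
  ∘ (idw [:: B12] ⊗ cp_unit eta1 eta2))).
  by apply: esym; pack_congr.
by rewrite E.
Qed.

Lemma comulP1l : (eps1 ⊗ eps2 ⊗ id12) ∘ comulP = id12.
Proof.
have [_ [_ _ [_ E _]] _] := ccpb_bialgebra H.
apply: pack_inj.
transitivity (pack ((cp_counit eps1 eps2 ⊗ idw [:: B12])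
  ∘ cp_comul Delta2 phi12 rhoh)).
  by apply: esym; pack_congr.
by rewrite E.
Qed.

Lemma comulP1r : (id12 ⊗ (eps1 ⊗ eps2)) ∘ comulP = id12.
Proof.
have [_ [_ _ [_ _ E]] _] := ccpb_bialgebra H.
apply: pack_inj.
transitivity (pack ((idw [:: B12] ⊗ cp_counit eps1 eps2)
  ∘ cp_comul Delta2 phi12 rhoh)).
  by apply: esym; pack_congr.
by rewrite E.
Qed.

Lemma comulP_mulP :
  comulP ∘ mulP
  = (mulP ⊗ mulP) ∘ (id12 ⊗ Theta ⊗ id12) ∘ (comulP ⊗ comulP).
Proof.
have [_ _ [_ E _ _ _]] := ccpb_bialgebra H.
apply: pack_inj.
transitivity (pack (cp_comul Delta2 phi12 rhoh ∘ cp_mul m1 phi21 sigmah)).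
  by apply: esym; pack_congr.
rewrite E; pack_congr.
transitivity (pack (braid B12 B12)).
  exact: (pack_braidw [:: B12] [:: B12]).
exact: esym (pack_braidw [:: B1; B2] [:: B1; B2]).
Qed.

Lemma comulP_unit : comulP ∘ (eta1 ⊗ eta2) = eta1 ⊗ eta2 ⊗ (eta1 ⊗ eta2).
Proof.
have [_ _ [_ _ E _ _]] := ccpb_bialgebra H.
apply: pack_inj.
transitivity (pack (cp_comul Delta2 phi12 rhoh ∘ cp_unit eta1 eta2)).
  by apply: esym; pack_congr.
by rewrite E; pack_congr.
Qed.

Lemma counit_mulP : (eps1 ⊗ eps2) ∘ mulP = eps1 ⊗ eps2 ⊗ (eps1 ⊗ eps2).
Proof.
have [_ _ [_ _ _ E _]] := ccpb_bialgebra H.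
apply: pack_inj.
transitivity (pack (cp_counit eps1 eps2 ∘ cp_mul m1 phi21 sigmah)).
  by apply: esym; pack_congr.
by rewrite E; pack_congr.
Qed.

Let eps1_eta1 : eps1 ∘ eta1 = idw [::] := ccpb_normalized H.

Lemma eps2_eta2 : eps2 ∘ eta2 = idw [::].
Proof.
have [_ _ [_ _ _ _ E]] := ccpb_bialgebra H.
have {}E : (eps1 ⊗ eps2) ∘ (eta1 ⊗ eta2) = idw [::] by [].
by rewrite -E; diagram tt with eps1_eta1.
Qed.

Lemma m1P : is_algebra m1 eta1.
Proof. by have [[]] := ccpb_bialgebra H. Qed.

Lemma Delta2P : is_coalgebra Delta2 eps2.
Proof. by have [_ []] := ccpb_bialgebra H. Qed.

Let m1A := let: And3 E _ _ := m1P in E.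
Let m1_1l := let: And3 _ E _ := m1P in E.
Let m1_1r := let: And3 _ _ E := m1P in E.
Let Delta2A := let: And3 E _ _ := Delta2P in E.
Let Delta2_1l := let: And3 _ E _ := Delta2P in E.
Let Delta2_1r := let: And3 _ _ E := Delta2P in E.

(** With the unit laws of P, this condition makes η1 ⊗ η2 behave as a unit in
    each factor separately. *)
Lemma phi21_def : phi21 = (m1 ⊗ id2) ∘ (id1 ⊗ sigmah) ∘ (phi21 ⊗ eta2).
Proof. by have [[]] := ccpb_bialgebra H. Qed.

Lemma phi12_def : phi12 = (eps1 ⊗ phi12) ∘ (rhoh ⊗ id2) ∘ (id1 ⊗ Delta2).
Proof. by have [_ []] := ccpb_bialgebra H. Qed.

Let mulPE : mulP = (m1 ⊗ id2) ∘ (m1 ⊗ sigmah) ∘ (id1 ⊗ phi21 ⊗ id2) := erefl.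
Let comulPE :
  comulP = (id1 ⊗ phi12 ⊗ id2) ∘ (rhoh ⊗ Delta2) ∘ (id1 ⊗ Delta2) := erefl.
Let alphaE : alpha = m2 ∘ (mu_r ⊗ id2) := erefl.
Let betaE : beta = (nu_r ⊗ id2) ∘ Delta2 := erefl.
Let lambdaE : lambda = m1 ∘ (id1 ⊗ mu_l) := erefl.
Let zetaE : zeta = (id1 ⊗ nu_l) ∘ Delta1 := erefl.
Let phi12E : phi12 = (m2 ⊗ m1) ∘ (id2 ⊗ Ψ12 ⊗ id1) ∘ (nu_l ⊗ nu_r) := erefl.
Let phi21E :
  phi21 = (mu_l ⊗ mu_r) ∘ (id2 ⊗ Ψ21 ⊗ id1) ∘ (Delta2 ⊗ Delta1) := erefl.
Let sigmahE :
  sigmah = (sigma ⊗ alpha) ∘ (id2 ⊗ Ψ22 ⊗ id12) ∘ (Delta2 ⊗ beta) := erefl.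
Let rhohE : rhoh = (lambda ⊗ m1) ∘ (id12 ⊗ Ψ11 ⊗ id1) ∘ (zeta ⊗ rho) := erefl.
Let kappaE : kappa = m1 ∘ (m1 ⊗ sigma) ∘ (id1 ⊗ phi21 ⊗ id2) := erefl.
Let omegaE : omega = (id1 ⊗ phi12 ⊗ id2) ∘ (rho ⊗ Delta2) ∘ Delta2 := erefl.

Let U2 := ccpb_U2 H.
Let Delta1_eta1 : Delta1 ∘ eta1 = eta1 ⊗ eta1.
Proof. by have [] := ccpb_U1 H. Qed.
Let Delta1_1r : (id1 ⊗ eps1) ∘ Delta1 = id1.
Proof. by have [_ []] := ccpb_U1 H. Qed.
Let Delta1_1l : (eps1 ⊗ id1) ∘ Delta1 = id1.
Proof. by have [_ []] := ccpb_U1 H. Qed.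
Let eps2_m2 : eps2 ∘ m2 = eps2 ⊗ eps2.
Proof. by have [] := ccpb_U1 H. Qed.
Let m2_1r : m2 ∘ (id2 ⊗ eta2) = id2.
Proof. by have [_ _ _ []] := ccpb_U1 H. Qed.
Let m2_1l : m2 ∘ (eta2 ⊗ id2) = id2.
Proof. by have [_ _ _ []] := ccpb_U1 H. Qed.
Let mur_eta1 : mu_r ∘ (id2 ⊗ eta1) = id2 := proj1 (ccpb_U3 H).
Let nul_eps2 : (eps2 ⊗ id1) ∘ nu_l = id1 := proj2 (ccpb_U3 H).

(** Both sides are the product of η1 ⊗ η2 and id ⊗ η2 in P.  The other seven
    lemmas of this kind use the products of η1 ⊗ η2 with i1 and i2 on either
    side, and the dual expressions. *)
Lemma phi21_eta2 : phi21 ∘ (eta2 ⊗ id1) = id1 ⊗ eta2.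
Proof.
transitivity (mulP ∘ (eta1 ⊗ eta2 ⊗ id12) ∘ (id1 ⊗ eta2)); last diagram mulP1l.
diagram phi21_def with (mulPE, m1_1l).
Qed.

Lemma phi21_eta1 : phi21 ∘ (id2 ⊗ eta1) = eta1 ⊗ id2.
Proof.
transitivity (mulP ∘ (id12 ⊗ (eta1 ⊗ eta2)) ∘ (eta1 ⊗ id2));
  last diagram mulP1r.
diagram phi21_def with (mulPE, m1_1l).
Qed.

Lemma sigmah_eta2l : sigmah ∘ (eta2 ⊗ id2) = eta1 ⊗ id2.
Proof.
transitivity (mulP ∘ (eta1 ⊗ eta2 ⊗ id12) ∘ (eta1 ⊗ id2)); last diagram mulP1l.
diagram tt with (mulPE, phi21_eta2, m1_1l, m1_1l).
Qed.

Lemma sigmah_eta2r : sigmah ∘ (id2 ⊗ eta2) = eta1 ⊗ id2.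
Proof.
transitivity (mulP ∘ (id12 ⊗ (eta1 ⊗ eta2)) ∘ (eta1 ⊗ id2));
  last diagram mulP1r.
diagram tt with (mulPE, phi21_eta1, m1_1l, m1_1l).
Qed.

Lemma phi12_eps1 : (id2 ⊗ eps1) ∘ phi12 = eps1 ⊗ id2.
Proof.
transitivity ((eps1 ⊗ id2) ∘ ((id12 ⊗ (eps1 ⊗ eps2)) ∘ comulP));
  last diagram comulP1r.
diagram phi12_def with (comulPE, Delta2_1r).
Qed.

Lemma phi12_eps2 : (eps2 ⊗ id1) ∘ phi12 = id1 ⊗ eps2.
Proof.
transitivity ((id1 ⊗ eps2) ∘ ((eps1 ⊗ eps2 ⊗ id12) ∘ comulP));
  last diagram comulP1l.
diagram phi12_def with (comulPE, Delta2_1r).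
Qed.

Lemma rhoh_eps1r : (id1 ⊗ eps1) ∘ rhoh = id1 ⊗ eps2.
Proof.
transitivity ((id1 ⊗ eps2) ∘ ((id12 ⊗ (eps1 ⊗ eps2)) ∘ comulP));
  last diagram comulP1r.
diagram tt with (comulPE, phi12_eps1, Delta2_1r, Delta2_1r).
Qed.

Lemma rhoh_eps1l : (eps1 ⊗ id1) ∘ rhoh = id1 ⊗ eps2.
Proof.
transitivity ((id1 ⊗ eps2) ∘ ((eps1 ⊗ eps2 ⊗ id12) ∘ comulP));
  last diagram comulP1l.
diagram tt with (comulPE, phi12_eps2, Delta2_1r, Delta2_1r).
Qed.

(** The counit of P is multiplicative, and its restriction along i1 is ε1. *)
Lemma eps1_m1 : eps1 ∘ m1 = eps1 ⊗ eps1.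
Proof.
transitivity ((eps1 ⊗ eps2) ∘ mulP ∘ (id1 ⊗ eta2 ⊗ id1 ⊗ eta2)).
  diagram tt with (mulPE, phi21_eta2, sigmah_eta2l, m1_1r, eps2_eta2).
diagram (counit_mulP, eps2_eta2, eps2_eta2).
Qed.

Lemma Delta2_eta2 : Delta2 ∘ eta2 = eta2 ⊗ eta2.
Proof.
transitivity ((eps1 ⊗ id2 ⊗ eps1 ⊗ id2) ∘ comulP ∘ (eta1 ⊗ eta2)).
  diagram tt with (comulPE, phi12_eps1, rhoh_eps1r, Delta2_1l, eps1_eta1).
diagram (comulP_unit, eps1_eta1, eps1_eta1).
Qed.

(** The unital identities recover the given structure morphisms from σ̂, φ21,
    ρ̂ and φ12.  As those of σ and ρ are not assumed, they are derived along the
    way from the bialgebra P: ε1 σ is the counit of P on products from B2, and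
    ρ η2 is a component of the comultiplication of the unit. *)
Lemma sigmah_proj1 : (id1 ⊗ eps2) ∘ sigmah = sigma.
Proof.
diagram (sigmahE, alphaE, betaE, eps2_m2, U2_eps2_mur U2, braid_counitl B2 eps2,
  Delta2_1r, U2_eps1_nur U2, Delta2_1r).
Qed.

Lemma eps1_sigma : eps1 ∘ sigma = eps2 ⊗ eps2.
Proof.
transitivity ((eps1 ⊗ eps2) ∘ mulP ∘ (eta1 ⊗ id2 ⊗ eta1 ⊗ id2)).
  diagram (esym sigmah_proj1) with (mulPE, phi21_eta1, m1_1l, m1_1l).
diagram (counit_mulP, eps1_eta1, eps1_eta1).
Qed.

Lemma sigmah_proj2 : (eps1 ⊗ id2) ∘ sigmah = m2.
Proof.
diagram (sigmahE, alphaE, betaE, eps1_sigma, Delta2_1l, braid_counitr B2 eps2,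
  U2_eps2_nur U2, Delta2_1l, mur_eta1).
Qed.

Lemma sigma_eta2l : sigma ∘ (eta2 ⊗ id2) = eta1 ∘ eps2.
Proof. diagram (esym sigmah_proj1, sigmah_eta2l). Qed.

Lemma sigma_eta2r : sigma ∘ (id2 ⊗ eta2) = eta1 ∘ eps2.
Proof. diagram (esym sigmah_proj1, sigmah_eta2r). Qed.

Lemma phi21_proj1 : (id1 ⊗ eps2) ∘ phi21 = mu_l.
Proof.
diagram (phi21E, U2_eps2_mur U2, braid_counitl B1 eps2, Delta2_1r, Delta1_1r).
Qed.

Lemma phi21_proj2 : (eps1 ⊗ id2) ∘ phi21 = mu_r.
Proof.
diagram (phi21E, U2_eps1_mul U2, braid_counitr B2 eps1, Delta2_1l, Delta1_1l).
Qed.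

Lemma rhoh_inj2 : rhoh ∘ (eta1 ⊗ id2) = rho.
Proof.
diagram (rhohE, lambdaE, zetaE, Delta1_eta1, U2_nul_eta1 U2, braid_unitl B1
  eta1,
  U2_mul_eta2 U2, m1_1l, m1_1l).
Qed.

Lemma rho_eta2 : rho ∘ eta2 = eta1 ⊗ eta1.
Proof.
transitivity ((id1 ⊗ eps2 ⊗ id1 ⊗ eps2) ∘ comulP ∘ (eta1 ⊗ eta2)).
  diagram (esym rhoh_inj2) with (comulPE, phi12_eps2, Delta2_1r, Delta2_1r).
diagram (comulP_unit, eps2_eta2, eps2_eta2).
Qed.

Lemma rhoh_inj1 : rhoh ∘ (id1 ⊗ eta2) = Delta1.
Proof.
diagram (rhohE, lambdaE, zetaE, rho_eta2, braid_unitr B1 eta1,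
  U2_mul_eta1 U2, nul_eps2, m1_1r, m1_1r).
Qed.

Lemma rho_eps1l : (eps1 ⊗ id1) ∘ rho = eta1 ∘ eps2.
Proof. diagram (esym rhoh_inj2, rhoh_eps1l). Qed.

Lemma rho_eps1r : (id1 ⊗ eps1) ∘ rho = eta1 ∘ eps2.
Proof. diagram (esym rhoh_inj2, rhoh_eps1r). Qed.

Lemma phi12_inj1 : phi12 ∘ (id1 ⊗ eta2) = nu_l.
Proof.
diagram (phi12E, U2_nur_eta2 U2, braid_unitr B1 eta2, m2_1r, m1_1r).
Qed.

Lemma phi12_inj2 : phi12 ∘ (eta1 ⊗ id2) = nu_r.
Proof.
diagram (phi12E, U2_nul_eta1 U2, braid_unitl B2 eta1, m2_1l, m1_1l).
Qed.

(** Components of the structure of P.  The suffixes 1 and 2 of the names refer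
    to the inclusions id ⊗ η2, η1 ⊗ id and to the projections id ⊗ ε2,
    ε1 ⊗ id. *)
Lemma mulP_proj1 : (id1 ⊗ eps2) ∘ mulP = kappa.
Proof. diagram (mulPE, sigmah_proj1) with kappaE. Qed.

Lemma mulP_proj2 : (eps1 ⊗ id2) ∘ mulP = eps1 ⊗ alpha.
Proof.
diagram (mulPE, eps1_m1, eps1_m1, sigmah_proj2, phi21_proj2) with alphaE.
Qed.

Lemma comulP_inj1 : comulP ∘ (id1 ⊗ eta2) = zeta ⊗ eta2.
Proof.
diagram (comulPE, Delta2_eta2, Delta2_eta2, rhoh_inj1, phi12_inj1) with zetaE.
Qed.

Lemma comulP_inj2 : comulP ∘ (eta1 ⊗ id2) = omega.
Proof. diagram (comulPE, rhoh_inj2) with omegaE. Qed.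

Lemma mulP_11 : mulP ∘ (id1 ⊗ eta2 ⊗ id1 ⊗ eta2) = m1 ⊗ eta2.
Proof. diagram (mulPE, phi21_eta2, sigmah_eta2l, m1_1r). Qed.

Lemma mulP_21 : mulP ∘ (eta1 ⊗ id2 ⊗ id1 ⊗ eta2) = phi21.
Proof. diagram (mulPE, m1_1l) with phi21_def. Qed.

Lemma mulP_22 : mulP ∘ (eta1 ⊗ id2 ⊗ eta1 ⊗ id2) = sigmah.
Proof. diagram (mulPE, phi21_eta1, m1_1l, m1_1l). Qed.

Lemma comulP_22 : (eps1 ⊗ id2 ⊗ eps1 ⊗ id2) ∘ comulP = eps1 ⊗ Delta2.
Proof. diagram (comulPE, phi12_eps1, rhoh_eps1l, Delta2_1l). Qed.

Lemma comulP_21 : (eps1 ⊗ id2 ⊗ id1 ⊗ eps2) ∘ comulP = phi12.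
Proof. diagram (comulPE, Delta2_1r) with phi12_def. Qed.

Lemma comulP_11 : (id1 ⊗ eps2 ⊗ id1 ⊗ eps2) ∘ comulP = rhoh.
Proof. diagram (comulPE, phi12_eps2, Delta2_1r, Delta2_1r). Qed.

(** κ is the B1-component of a product in P, and λ is the case where the second
    factor comes from B1. *)
Lemma kappa_lambda : kappa ∘ (id12 ⊗ id1 ⊗ eta2) = lambda.
Proof. diagram (kappaE, sigma_eta2r, phi21_proj1, m1_1r) with lambdaE. Qed.

(** Dually, ω is the comultiplication of P on B2, and β is what remains when
    the first tensor factor is projected to B2. *)
Lemma omega_beta : (eps1 ⊗ id2 ⊗ id12) ∘ omega = beta.
Proof. diagram (omegaE, rho_eps1l, Delta2_1l, phi12_inj2) with betaE. Qed.

Lemma lambda_eta2 : lambda ∘ (id1 ⊗ eta2 ⊗ id1) = m1.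
Proof. diagram (lambdaE, U2_mul_eta2 U2). Qed.

Lemma beta_eps1 : (id2 ⊗ eps1 ⊗ id2) ∘ beta = Delta2.
Proof. diagram (betaE, U2_eps1_nur U2). Qed.

(** Naturality of the braiding of P with itself: it restricts to a braiding of a
    single factor. *)
Lemma Theta_eps1 :
  (id12 ⊗ eps1 ⊗ id2) ∘ Theta = Ψ[[:: B2], [:: B1; B2]] ∘ (eps1 ⊗ id2 ⊗ id12).
Proof.
have E := braidw_nat (eps1 ⊗ id2 : mor [:: B1; B2] [:: B2]) id12.
transitivity ((id12 ⊗ (eps1 ⊗ id2)) ∘ Theta); first diagram.
exact: esym E.
Qed.

Lemma Theta_eta2 :
  Theta ∘ (id1 ⊗ eta2 ⊗ id12) = (id12 ⊗ id1 ⊗ eta2) ∘ Ψ[[:: B1], [:: B1; B2]].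
Proof.
have E := braidw_nat (id1 ⊗ eta2 : mor [:: B1] [:: B1; B2]) id12.
transitivity ((id12 ⊗ (id1 ⊗ eta2)) ∘ Ψ[[:: B1], [:: B1; B2]]); last diagram.
exact: E.
Qed.

(** * Components of associativity *)

(** Associativity of products from B2, B1 and B1, projected to B2.  The
    restrictions and projections in the next lemmas can be read off from the
    intermediate term in the same way. *)
Lemma hopf_mur : is_right_module m1 eta1 mu_r.
Proof.
split=> //.
transitivity ((eps1 ⊗ id2) ∘ (mulP ∘ (mulP ⊗ id12))
  ∘ (eta1 ⊗ id2 ⊗ id1 ⊗ eta2 ⊗ id1 ⊗ eta2)).
  diagram tt with (mulP_proj2, mulP_21, phi21_proj2, alphaE, m2_1r).
rewrite mulPA; diagram (mulP_proj2, mulP_11, eps1_eta1, alphaE, m2_1r).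
Qed.

Lemma hopf_module_algebra_mul :
  mu_l ∘ (id2 ⊗ m1) = m1 ∘ (id1 ⊗ mu_l) ∘ (phi21 ⊗ id1).
Proof.
transitivity ((id1 ⊗ eps2) ∘ (mulP ∘ (id12 ⊗ mulP))
  ∘ (eta1 ⊗ id2 ⊗ id1 ⊗ eta2 ⊗ id1 ⊗ eta2)).
  diagram tt with (mulP_proj1, mulP_11, kappa_lambda, lambdaE, m1_1l).
rewrite -mulPA; diagram (mulP_proj1, mulP_21, kappa_lambda, lambdaE).
Qed.

Lemma hopf_weak_assoc_mul :
  m1 ∘ (id1 ⊗ mu_l) ∘ (sigmah ⊗ id1)
  = m1 ∘ (id1 ⊗ sigma) ∘ (phi21 ⊗ id2) ∘ (id2 ⊗ phi21).
Proof.
transitivity ((id1 ⊗ eps2) ∘ (mulP ∘ (mulP ⊗ id12))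
  ∘ (eta1 ⊗ id2 ⊗ eta1 ⊗ id2 ⊗ id1 ⊗ eta2)).
  diagram tt with (mulP_proj1, mulP_22, kappa_lambda, lambdaE).
rewrite mulPA; diagram (mulP_proj1, mulP_21, kappaE, m1_1l).
Qed.

Lemma hopf_module_algebra_mur :
  mu_r ∘ (m2 ⊗ id1) = m2 ∘ (mu_r ⊗ id2) ∘ (id2 ⊗ phi21).
Proof.
transitivity ((eps1 ⊗ id2) ∘ (mulP ∘ (mulP ⊗ id12))
  ∘ (eta1 ⊗ id2 ⊗ eta1 ⊗ id2 ⊗ id1 ⊗ eta2)).
  diagram tt with (mulP_proj2, mulP_22, sigmah_proj2, alphaE, m2_1r).
rewrite mulPA; diagram (mulP_proj2, mulP_21, eps1_eta1, alphaE).
Qed.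

Lemma hopf_cocycle :
  m1 ∘ (id1 ⊗ sigma) ∘ (sigmah ⊗ id2)
  = m1 ∘ (id1 ⊗ sigma) ∘ (phi21 ⊗ id2) ∘ (id2 ⊗ sigmah).
Proof.
transitivity ((id1 ⊗ eps2) ∘ (mulP ∘ (mulP ⊗ id12))
  ∘ (eta1 ⊗ id2 ⊗ eta1 ⊗ id2 ⊗ eta1 ⊗ id2)).
  diagram tt with (mulP_proj1, mulP_22, kappaE, phi21_eta1, m1_1r).
rewrite mulPA; diagram (mulP_proj1, mulP_22, kappaE, m1_1l).
Qed.

Lemma hopf_weak_assoc_m2 :
  m2 ∘ (m2 ⊗ id2) = m2 ∘ (mu_r ⊗ id2) ∘ (id2 ⊗ sigmah).
Proof.
transitivity ((eps1 ⊗ id2) ∘ (mulP ∘ (mulP ⊗ id12))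
  ∘ (eta1 ⊗ id2 ⊗ eta1 ⊗ id2 ⊗ eta1 ⊗ id2)).
  diagram tt with (mulP_proj2, mulP_22, sigmah_proj2, alphaE, mur_eta1).
rewrite mulPA; diagram (mulP_proj2, mulP_22, eps1_eta1, alphaE).
Qed.

(** * Components of coassociativity *)

Lemma hopf_nul : is_left_comodule Delta2 eps2 nu_l.
Proof.
split=> //.
transitivity ((eps1 ⊗ id2 ⊗ eps1 ⊗ id2 ⊗ id1 ⊗ eps2)
  ∘ ((comulP ⊗ id12) ∘ comulP) ∘ (id1 ⊗ eta2)).
  diagram tt with (comulP_22, comulP_21, phi12_inj1).
rewrite comulPA; diagram (comulP_21, comulP_inj1, phi12_inj1, zetaE, Delta1_1l).
Qed.

Lemma hopf_comodule_coalgebra_nur :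
  (Delta2 ⊗ id1) ∘ nu_r = (id2 ⊗ phi12) ∘ (nu_r ⊗ id2) ∘ Delta2.
Proof.
transitivity ((eps1 ⊗ id2 ⊗ eps1 ⊗ id2 ⊗ id1 ⊗ eps2)
  ∘ ((comulP ⊗ id12) ∘ comulP) ∘ (eta1 ⊗ id2)).
  diagram tt with (comulP_22, comulP_21, phi12_inj2).
rewrite comulPA; diagram (comulP_21, comulP_inj2, omega_beta, betaE).
Qed.

Lemma hopf_weak_coassoc_nur :
  (id2 ⊗ rhoh) ∘ (nu_r ⊗ id2) ∘ Delta2
  = (phi12 ⊗ id1) ∘ (id1 ⊗ phi12) ∘ (rho ⊗ id2) ∘ Delta2.
Proof.
transitivity ((eps1 ⊗ id2 ⊗ id1 ⊗ eps2 ⊗ id1 ⊗ eps2)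
  ∘ ((id12 ⊗ comulP) ∘ comulP) ∘ (eta1 ⊗ id2)).
  diagram tt with (comulP_11, comulP_inj2, omega_beta, betaE).
rewrite -comulPA; diagram (comulP_21, comulP_inj2, omegaE, Delta2_1r).
Qed.

Lemma hopf_comodule_coalgebra_nul :
  (id2 ⊗ Delta1) ∘ nu_l = (phi12 ⊗ id1) ∘ (id1 ⊗ nu_l) ∘ Delta1.
Proof.
transitivity ((eps1 ⊗ id2 ⊗ id1 ⊗ eps2 ⊗ id1 ⊗ eps2)
  ∘ ((id12 ⊗ comulP) ∘ comulP) ∘ (id1 ⊗ eta2)).
  diagram tt with (comulP_11, comulP_inj1, rhoh_inj1, zetaE, Delta1_1l).
rewrite -comulPA; diagram (comulP_21, comulP_inj1, eps2_eta2, zetaE).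
Qed.

Lemma hopf_cycle :
  (id1 ⊗ rhoh) ∘ (rho ⊗ id2) ∘ Delta2
  = (rhoh ⊗ id1) ∘ (id1 ⊗ phi12) ∘ (rho ⊗ id2) ∘ Delta2.
Proof.
transitivity ((id1 ⊗ eps2 ⊗ id1 ⊗ eps2 ⊗ id1 ⊗ eps2)
  ∘ ((id12 ⊗ comulP) ∘ comulP) ∘ (eta1 ⊗ id2)).
  diagram tt with (comulP_11, comulP_inj2, omegaE, phi12_eps2, Delta2_1l).
rewrite -comulPA; diagram (comulP_11, comulP_inj2, omegaE, Delta2_1r).
Qed.

Lemma hopf_weak_coassoc_Delta1 :
  (id1 ⊗ Delta1) ∘ Delta1 = (rhoh ⊗ id1) ∘ (id1 ⊗ nu_l) ∘ Delta1.
Proof.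
transitivity ((id1 ⊗ eps2 ⊗ id1 ⊗ eps2 ⊗ id1 ⊗ eps2)
  ∘ ((id12 ⊗ comulP) ∘ comulP) ∘ (id1 ⊗ eta2)).
  diagram tt with (comulP_11, comulP_inj1, rhoh_inj1, zetaE, nul_eps2).
rewrite -comulPA; diagram (comulP_11, comulP_inj1, eps2_eta2, zetaE).
Qed.

(** * Components of multiplicativity of the comultiplication *)

Lemma hopf_cycle_cocycle :
  rhoh ∘ sigmah = (kappa ⊗ kappa) ∘ (id12 ⊗ Theta ⊗ id12) ∘ (omega ⊗ omega).
Proof.
transitivity ((id1 ⊗ eps2 ⊗ id1 ⊗ eps2) ∘ (comulP ∘ mulP)
  ∘ (eta1 ⊗ id2 ⊗ eta1 ⊗ id2)); first diagram tt with (comulP_11, mulP_22).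
rewrite comulP_mulP; diagram (mulP_proj1, mulP_proj1, comulP_inj2, comulP_inj2).
Qed.

Lemma hopf_module_coalgebra1 :
  rhoh ∘ phi21 = (kappa ⊗ lambda) ∘ (id12 ⊗ Theta ⊗ id1) ∘ (omega ⊗ zeta).
Proof.
transitivity ((id1 ⊗ eps2 ⊗ id1 ⊗ eps2) ∘ (comulP ∘ mulP)
  ∘ (eta1 ⊗ id2 ⊗ id1 ⊗ eta2)); first diagram tt with (comulP_11, mulP_21).
rewrite comulP_mulP.
diagram (mulP_proj1, mulP_proj1, comulP_inj2, comulP_inj1, kappa_lambda).
Qed.

Lemma hopf_module_comodule :
  phi12 ∘ phi21 = (alpha ⊗ lambda) ∘ (id2 ⊗ Theta ⊗ id1) ∘ (beta ⊗ zeta).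
Proof.
transitivity ((eps1 ⊗ id2 ⊗ id1 ⊗ eps2) ∘ (comulP ∘ mulP)
  ∘ (eta1 ⊗ id2 ⊗ id1 ⊗ eta2)); first diagram tt with (comulP_21, mulP_21).
rewrite comulP_mulP.
diagram (mulP_proj2, mulP_proj1, comulP_inj2, comulP_inj1, kappa_lambda,
  omega_beta).
Qed.

Lemma hopf_comodule_algebra2 :
  phi12 ∘ sigmah = (alpha ⊗ kappa) ∘ (id2 ⊗ Theta ⊗ id12) ∘ (beta ⊗ omega).
Proof.
transitivity ((eps1 ⊗ id2 ⊗ id1 ⊗ eps2) ∘ (comulP ∘ mulP)
  ∘ (eta1 ⊗ id2 ⊗ eta1 ⊗ id2)); first diagram tt with (comulP_21, mulP_22).
rewrite comulP_mulP.
diagram (mulP_proj2, mulP_proj1, comulP_inj2, comulP_inj2, omega_beta).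
Qed.

Lemma hopf_module_coalgebra2 :
  Delta2 ∘ mu_r
  = (alpha ⊗ mu_r) ∘ (id2 ⊗ Ψ[[:: B2], [:: B1; B2]] ⊗ id1) ∘ (Delta2 ⊗ zeta).
Proof.
transitivity ((eps1 ⊗ id2 ⊗ eps1 ⊗ id2) ∘ (comulP ∘ mulP)
  ∘ (eta1 ⊗ id2 ⊗ id1 ⊗ eta2));
  first diagram tt with (comulP_22, mulP_21, phi21_proj2).
have alpha_eta2 : alpha ∘ (id2 ⊗ id1 ⊗ eta2) = mu_r.
  diagram (alphaE, m2_1r).
rewrite comulP_mulP.
diagram (mulP_proj2, mulP_proj2, comulP_inj2, comulP_inj1, Theta_eps1,
  omega_beta, beta_eps1, alpha_eta2).
Qed.

Lemma hopf_comodule_algebra1 :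
  nu_l ∘ m1
  = (alpha ⊗ m1) ∘ (id2 ⊗ Ψ[[:: B1], [:: B1; B2]] ⊗ id1) ∘ (nu_l ⊗ zeta).
Proof.
transitivity ((eps1 ⊗ id2 ⊗ id1 ⊗ eps2) ∘ (comulP ∘ mulP)
  ∘ (id1 ⊗ eta2 ⊗ id1 ⊗ eta2));
  first diagram tt with (comulP_21, mulP_11, phi12_inj1).
have zeta_eps1 : (eps1 ⊗ id2 ⊗ id1) ∘ zeta = nu_l.
  diagram (zetaE, Delta1_1l).
rewrite comulP_mulP.
diagram (mulP_proj2, mulP_proj1, comulP_inj1, comulP_inj1, kappa_lambda,
  Theta_eta2, lambda_eta2, zeta_eps1).
Qed.

(** The computation yields κ on the left, where the condition has λ: one leg of
    the second comultiplication enters σ.  The identity that expresses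
    (μ_l ⊗ id)(id ⊗ Δ1) through σ removes it, after being carried across the
    braiding. *)
Lemma hopf_algebra_coalgebra1 :
  Delta1 ∘ m1
  = (lambda ⊗ m1) ∘ (id12 ⊗ Ψ[[:: B1], [:: B1]] ⊗ id1) ∘ (zeta ⊗ Delta1).
Proof.
transitivity ((id1 ⊗ eps2 ⊗ id1 ⊗ eps2) ∘ (comulP ∘ mulP)
  ∘ (id1 ⊗ eta2 ⊗ id1 ⊗ eta2));
  first diagram tt with (comulP_11, mulP_11, rhoh_inj1).
have E : ((m1 ∘ (id1 ⊗ sigma) ∘ (phi21 ⊗ id2)) ⊗ id1) ∘ (id2 ⊗ zeta)
    = (mu_l ⊗ id1) ∘ (id2 ⊗ Delta1).
  diagram zetaE with (ccpb_mul H).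
have S := eq_under_braid B1 E.
rewrite comulP_mulP.
diagram (mulP_proj1, mulP_proj1, comulP_inj1, comulP_inj1, kappa_lambda,
  Theta_eta2, lambda_eta2, kappaE,
  m1A, S) with lambdaE.
Qed.

(** Dual to the previous lemma: ω appears where the condition has β.
    Coassociativity of Δ2 writes ω as (K ⊗ id) Δ2, and the identity for
    (m2 ⊗ id)(id ⊗ ν_r) replaces K by ν_r. *)
Lemma hopf_algebra_coalgebra2 :
  Delta2 ∘ m2
  = (m2 ⊗ alpha) ∘ (id2 ⊗ Ψ[[:: B2], [:: B2]] ⊗ id12) ∘ (Delta2 ⊗ beta).
Proof.
transitivity ((eps1 ⊗ id2 ⊗ eps1 ⊗ id2) ∘ (comulP ∘ mulP)
  ∘ (eta1 ⊗ id2 ⊗ eta1 ⊗ id2));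
  first diagram tt with (comulP_22, mulP_22, sigmah_proj2).
pose K : mor [:: B2] [:: B1; B2; B1] := (id1 ⊗ phi12) ∘ (rho ⊗ id2) ∘ Delta2.
have KE : K = (id1 ⊗ phi12) ∘ (rho ⊗ id2) ∘ Delta2 by [].
have omegaK : omega = (K ⊗ id2) ∘ Delta2.
  diagram omegaE with (KE, Delta2A).
have E : (alpha ⊗ id1) ∘ (id2 ⊗ K) = (m2 ⊗ id1) ∘ (id2 ⊗ nu_r).
  diagram (alphaE, KE) with (ccpb_nur H).
have S := eq_under_braid B2 E.
rewrite comulP_mulP.
diagram (mulP_proj2, mulP_proj2, comulP_inj2, comulP_inj2, Theta_eps1,
  omega_beta, beta_eps1, omegaK, S) with betaE.
Qed.

Lemma Hopf_datum_of_ccpb : is_Hopf_datum D.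
Proof.
split.
- exact: m1P.
- by split; [exact: eps1_m1 | exact: eps1_eta1].
- exact: Delta2P.
- by split; [exact: Delta2_eta2 | exact: eps2_eta2].
- exact: hopf_nul.
- exact: hopf_mur.
- exact: ccpb_U1 H.
- exact: U2.
- split; [split | | split |].
  + exact: sigma_eta2l.
  + exact: sigma_eta2r.
  + exact: eps1_sigma.
  + exact: rho_eps1r.
  + exact: rho_eps1l.
  + exact: rho_eta2.
- exact: hopf_weak_assoc_m2.
- exact: hopf_weak_coassoc_Delta1.
- exact: hopf_weak_assoc_mul.
- exact: hopf_weak_coassoc_nur.
- exact: hopf_module_algebra_mul.
- exact: hopf_module_algebra_mur.
- exact: hopf_comodule_coalgebra_nul.
- exact: hopf_comodule_coalgebra_nur.
- exact: hopf_cocycle.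
- exact: hopf_cycle.
- exact: hopf_algebra_coalgebra1.
- exact: hopf_algebra_coalgebra2.
- exact: hopf_module_coalgebra1.
- exact: hopf_module_coalgebra2.
- exact: hopf_comodule_algebra1.
- exact: hopf_comodule_algebra2.
- exact: hopf_module_comodule.
- exact: hopf_cycle_cocycle.
Qed.

End CocycleCrossProduct.

Theorem proposition4p2 (C : sbmcat) (idemC : split_idempotents C) (B1 B2 : C)
    (D : structure_morphisms B1 B2) :
  is_cocycle_cross_product_bialgebra D -> is_Hopf_datum D.
Proof. exact: Hopf_datum_of_ccpb. Qed.
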